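(* Let $b$ be a power of three. With probability one: (1) for every point $\xi\in K$, $v^{\bullet}_b(\xi)\geq 0$; and (2) for every real number $v\geq 0$, $\dim_H(\mathcal{V}^{\bullet}_b(v)\cap K)=\frac{\kappa}{v+1}$.
   Context: $\mathbb{T}=\mathbb{R}/\mathbb{Z}$ with quotient distance $d$. $K$ is the image in $\mathbb{T}$ of the middle-third Cantor set, $\kappa=\log2/\log3$. For $j\ge1$, let $\mathcal{K}^j$ be the set of integers $k\in\{0,\dots,b^j-1\}$ with $\gcd(k,b^j)=1$, and $\mathcal{K}^j_K$ the set of $k\in\mathcal{K}^j$ with $kb^{-j}\in K$. Let $(Y_{j,k})_{j\ge1,k\in\mathcal{K}^j}$ be independent random points of $\mathbb{T}$, with $Y_{j,k}$ distributed according to the normalized $\kappa$-dimensional Hausdorff measure on $K$ if $k\in\mathcal{K}^j_K$ and according to Lebesgue measure on $\mathbb{T}$ otherwise. For $v\in\mathbb{R}$ let $\mathcal{F}_b(v)=\{\xi\in\mathbb{T}: d(\xi,Y_{j,k})<b^{-(v+1)j}\text{ for infinitely many pairs }(j,k)\text{ with }j\ge1,k\in\mathcal{K}^j\}$, $v^{\bullet}_b(\xi)=\sup\{v\in\mathbb{R}:\xi\in\mathcal{F}_b(v)\}$, and $\mathcal{V}^{\bullet}_b(v)=\{\xi\in\mathbb{T}: v^{\bullet}_b(\xi)\ge v\}$. $\dim_H$ is Hausdorff dimension. *)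

(* Defs.v *)
From HB Require Import structures.
From mathcomp Require Import all_boot all_order all_algebra.
From mathcomp Require Import all_classical all_reals all_analysis.
Set Implicit Arguments. Unset Strict Implicit. Unset Printing Implicit Defensive.
Import Order.TTheory GRing.Theory Num.Theory.
Import numFieldNormedType.Exports.
Local Open Scope classical_set_scope.
Local Open Scope ring_scope.

Definition torus {R : realType} : set R := `[0, 1[.

(** Fractional part and the quotient distance d on T = R/Z:
    d(x,y) = distance from x - y to the nearest integer. *)
Definition fracR {R : realType} (z : R) : R := z - (Num.floor z)%:~R.
Definition dT {R : realType} (x y : R) : R :=
  Order.min (fracR (x - y)) (1 - fracR (x - y)).

(** Middle-third Cantor set C = \bigcap_n C_n, where C_n is the union of the
    2^n closed intervals [a, a + 3^-n], a = sum_{i<n} d_i 3^-(i+1), d_i in {0,2}. *)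
Definition cantor_left {R : realType} (n : nat) (d : nat -> bool) : R :=
  \sum_(i < n) (if d i then 2 else 0) / 3 ^+ i.+1.
Definition cantor_set {R : realType} : set R :=
  [set x | forall n : nat, exists d : nat -> bool,
      cantor_left n d <= x <= cantor_left n d + (3 ^+ n)^-1].

(** K : the image of the Cantor set in T (1 is identified with 0, both in C). *)
Definition Kset {R : realType} : set R := cantor_set `&` torus.

Definition kappa {R : realType} : R := ln 2 / ln 3.

(** Diameter with respect to d (sup of the bounded set of distances; 0 for
    the empty set). *)
Definition diamT {R : realType} (U : set R) : R :=
  sup [set dT x y | x in U & y in U].

Definition diam_pow {R : realType} (s : R) (U : set R) : R :=
  if asbool (U = set0) then 0 else diamT U `^ s.

Definition hausdorff_approx {R : realType} (s delta : R) (A : set R) : \bar R :=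
  ereal_inf [set (\sum_(i <oo) ((diam_pow s (U i))%:E))%E
            | U in [set U : nat -> set R |
                     (forall i, U i `<=` torus) /\
                     (forall i, diamT (U i) <= delta) /\
                     A `<=` \bigcup_i U i]].

(** s-dimensional Hausdorff (outer) measure on T: limit as delta -> 0+,
    i.e. the supremum over delta > 0 of the nondecreasing approximations. *)
Definition hausdorff_measure {R : realType} (s : R) (A : set R) : \bar R :=
  ereal_sup [set hausdorff_approx s delta A | delta in [set delta : R | 0 < delta]].

Definition hausdorff_dim {R : realType} (A : set R) : \bar R :=
  ereal_inf [set s%:E | s in [set s : R | 0 <= s /\ hausdorff_measure s A = 0%E]].

Definition mutually_independent {d : measure_display} {Omega : measurableType d}
  {R : realType} (P : probability Omega R) {I : eqType} (D : set I)
  (X : I -> Omega -> R) : Prop :=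
  forall (s : seq I) (B : I -> set R),
    uniq s -> (forall i, i \in s -> D i) -> (forall i, measurable (B i)) ->
    P (\bigcap_(i in [set` s]) (X i @^-1` B i)) =
    (\prod_(i <- s) P (X i @^-1` B i))%E.

Definition Kj (b j k : nat) : Prop := (k < b ^ j)%N /\ coprime k (b ^ j).
Definition KjK {R : realType} (b j k : nat) : Prop :=
  Kj b j k /\ @Kset R (k%:R / (b ^ j)%:R).

Definition idx (b : nat) : set (nat * nat) :=
  [set jk | (1 <= jk.1)%N /\ Kj b jk.1 jk.2].

Definition Fb {R : realType} (b : nat) (Y : nat -> nat -> R) (v : R) : set R :=
  [set xi | torus xi /\
     ~ finite_set [set jk : nat * nat | idx b jk /\
          dT xi (Y jk.1 jk.2) < (b%:R : R) `^ (- ((v + 1) * jk.1%:R))]].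

Definition vbullet {R : realType} (b : nat) (Y : nat -> nat -> R) (xi : R) : \bar R :=
  ereal_sup [set v%:E | v in [set v : R | Fb b Y v xi]].

Definition Vbullet {R : realType} (b : nat) (Y : nat -> nat -> R) (v : R) : set R :=
  [set xi | torus xi /\ (v%:E <= vbullet b Y xi)%E].

(* Main.v *)
Require Import Defs.
From HB Require Import structures.
From mathcomp Require Import all_boot all_order all_algebra.
From mathcomp Require Import all_classical all_reals all_analysis.
From mathcomp Require Import measurable_realfun.
From mathcomp Require Import ring lra zify.
Import Order.TTheory GRing.Theory Num.Theory.
Import numFieldNormedType.Exports.
Local Open Scope classical_set_scope.
Local Open Scope ring_scope.
Set Implicit Arguments. Unset Strict Implicit. Unset Printing Implicit Defensive.

(** Points of [K] are coded by branches of the binary tree, a word of length [n]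
being a Cantor cylinder of length [3^-n]. In each cylinder of level [n] the
normalized Hausdorff measure on [K] has mass at least [2^-(n+1)], so for [q]
fixed, [j = (q+1) i] and [n = m q i], the at least [2^(mj-1)] independent points
[Y_(j,k)] with [k b^-j] in [K] miss some cylinder of level [n] with probability
tending to [0]. Hence almost surely, for every [q] and infinitely many [i], every
cylinder of level [n] contains such a point; this gives (1).

For the lower bound in (2), every word of length [n] then extends to a word of
length about [mj(v+1)] whose cylinder lies in the ball of radius [b^-((v+1)j)]
about some [Y_(j,k)]. Using this forced extension along a very sparse sequence of
levels and splitting mass evenly at the other levels yields a mass on a subset of
the limsup set with [mass(cylinder) <= C diam^s] for any [s < kappa/(v+1)].

For the upper bound, cover by the balls of radius [b^-(alpha j)], [alpha < v+1],
that are centred at [Y_(j,k)] with [k b^-j] in [K] (at most [2 * 2^(mj)] of them)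
or, among the Lebesgue distributed ones, meet [K]; the expected sum of the
[s]-th powers of the diameters converges for [s > kappa/alpha] and
[s > 1/alpha - (1 - kappa)], and both thresholds are at most [kappa/(v+1)]
in the limit [alpha -> v+1]. *)

(** * Cantor cylinders and the distance on the torus *)

Section Cantor.
Context {R : realType}.
Implicit Types (x y z t : R) (n i : nat) (d : nat -> bool).

Lemma pow3V_gt0 n : 0 < (3 ^+ n)^-1 :> R.
Proof. by rewrite invr_gt0 exprn_gt0. Qed.

Lemma pow3VS n : (3 ^+ n)^-1 = 3 * (3 ^+ n.+1)^-1 :> R.
Proof. by rewrite exprS invfM mulrA mulfV ?mul1r. Qed.

Lemma pow3V_le m n : (m <= n)%N -> (3 ^+ n)^-1 <= (3 ^+ m)^-1 :> R.
Proof. by move=> mn; rewrite lef_pV2 ?posrE ?exprn_gt0// ler_eXn2l ?ltr1n. Qed.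

Definition cyl n d : set R :=
  `[cantor_left n d, cantor_left n d + (3 ^+ n)^-1].

Lemma cylE n d x :
  cyl n d x <-> cantor_left n d <= x <= cantor_left n d + (3 ^+ n)^-1.
Proof. by rewrite /cyl /= in_itv. Qed.

Lemma cantor_leftS n d : cantor_left n.+1 d =
  cantor_left n d + (d n)%:R * (2 * (3 ^+ n.+1)^-1) :> R.
Proof.
rewrite /cantor_left big_ord_recr /=; congr (_ + _).
by case: (d n); rewrite ?mul1r ?mul0r.
Qed.

Lemma cantor_left0 d : cantor_left 0 d = 0 :> R.
Proof. by rewrite /cantor_left big_ord0. Qed.

Lemma eq_cantor_left n d d' : (forall i, (i < n)%N -> d i = d' i) ->
  cantor_left n d = cantor_left n d' :> R.
Proof. by move=> dd'; apply: eq_bigr => i _; rewrite dd'. Qed.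

Lemma eq_cyl n d d' : (forall i, (i < n)%N -> d i = d' i) -> cyl n d = cyl n d'.
Proof. by move=> dd'; rewrite /cyl (eq_cantor_left dd'). Qed.

Lemma cantor_left_bounds n d :
  0 <= cantor_left n d :> R /\ cantor_left n d + (3 ^+ n)^-1 <= 1 :> R.
Proof.
elim: n => [|n [IH0 IH1]]; first by rewrite cantor_left0 expr0 invr1 add0r.
have p := pow3V_gt0 n.+1; rewrite (pow3VS n) in IH1.
by rewrite cantor_leftS; case: (d n); rewrite ?mul1r ?mul0r; split; lra.
Qed.

Lemma cyl_sub1 n d : cyl n.+1 d `<=` cyl n d.
Proof.
move=> x /cylE H; apply/cylE; move: H; rewrite (pow3VS n) cantor_leftS.
have := pow3V_gt0 n.+1.
by case: (d n) => p; rewrite ?mul1r ?mul0r => /andP[h1 h2]; apply/andP; split; lra.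
Qed.

Lemma cyl_sub m n d : (m <= n)%N -> cyl n d `<=` cyl m d.
Proof.
move=> /subnKC <-; elim: (n - m)%N => [|k IH]; first by rewrite addn0.
by rewrite addnS => x /cyl_sub1 /IH.
Qed.

(** The middle third removed between siblings of level [n] has length exactly [3^-n]. Strict
    closeness at one level implies it at all coarser levels, so the digits are fixed one after
    another. *)
Lemma cyl_sep n d d' x y : cyl n d x -> cyl n d' y ->
  `|x - y| < (3 ^+ n)^-1 -> forall i, (i < n)%N -> d i = d' i.
Proof.
elim: n => // n IH dx dy xy.
have p := pow3V_gt0 n.+1; have e := pow3VS n.
have agree : forall i, (i < n)%N -> d i = d' i.
  by apply: IH; [exact: cyl_sub1|exact: cyl_sub1|lra].
move=> i; rewrite ltnS leq_eqVlt => /predU1P[->|/agree//].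
move: dx dy => /cylE + /cylE; rewrite !cantor_leftS (eq_cantor_left agree).
move: xy; rewrite ltr_norml => /andP[a1 a2].
by case: (d n); case: (d' n) => //; rewrite ?mul1r ?mul0r => /andP[h1 h2] /andP[h3 h4]; lra.
Qed.

Lemma cyl_agree m n d d' x : (m <= n)%N -> cyl m d x -> cyl n d' x ->
  forall i, (i < m)%N -> d i = d' i.
Proof.
move=> mn dx d'x; apply: (cyl_sep dx (cyl_sub mn d'x)).
by rewrite subrr normr0 pow3V_gt0.
Qed.

Lemma cantor_left_split n N d : (n <= N)%N -> cantor_left N d =
  cantor_left n d + cantor_left N (fun i => (n <= i)%N && d i) :> R.
Proof.
move=> /subnKC <-; elim: (N - n)%N => [|k IH].
  rewrite addn0 [X in _ + X]big1 ?addr0// => i _.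
  by rewrite leqNgt ltn_ord mul0r.
by rewrite addnS !cantor_leftS {}IH leq_addr/= addrA.
Qed.

Lemma cantor_setE : cantor_set = [set x : R | forall n, exists d, cyl n d x].
Proof.
by apply/seteqP; split=> x /= Hx n; have [d /cylE] := Hx n; exists d => //; exact/cylE.
Qed.

(** Translation to the leftmost cylinder of level [n] erases the first [n] digits and keeps the
    later ones. *)
Lemma cantor_set_shift_down n d x : cantor_set x -> cyl n d x ->
  cantor_set (x - cantor_left n d).
Proof.
rewrite cantor_setE => Cx dx N; have [Nn|/ltnW nN] := leqP N n.
  exists (fun=> false); apply/cylE.
  have -> : cantor_left N (fun=> false) = 0 :> R by apply: big1 => i _; rewrite mul0r.
  have := pow3V_le Nn; have/cylE/andP[? ?] := dx.
  by move=> ?; apply/andP; split; lra.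
have [d' d'x] := Cx N; exists (fun i => (n <= i)%N && d' i).
have/cylE := d'x; rewrite (cantor_left_split d' nN).
rewrite (eq_cantor_left (cyl_agree nN dx d'x)) => /andP[? ?].
by apply/cylE/andP; split; lra.
Qed.

Lemma cantor_set_shift_up n m d x : (n <= m)%N -> cantor_set x -> 
  cyl m (fun=> false) x -> cantor_set (x + cantor_left n d).
Proof.
have zero k : cantor_left k (fun=> false) = 0 :> R by apply: big1 => i _; rewrite mul0r.
rewrite cantor_setE => nm Cx x0 N; have {x0} := cyl_sub nm x0 => x0.
have [Nn|/ltnW nN] := leqP N n.
  exists d; apply/(cyl_sub Nn)/cylE; have/cylE := x0.
  by rewrite zero => /andP[? ?]; apply/andP; split; lra.
have [d' d'x] := Cx N; have agr := cyl_agree nN x0 d'x.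
exists (fun i => if (i < n)%N then d i else d' i).
apply/cylE; rewrite (cantor_left_split _ nN).
rewrite [X in X + _](@eq_cantor_left n _ d); last by move=> i ->.
rewrite (@eq_cantor_left N _ d').
  by have/cylE/andP[? ?] := d'x; apply/andP; split; lra.
by move=> i _; rewrite leqNgt; case: ltnP => //= /agr.
Qed.

(** The only point common to all cylinders along [d]. *)
Definition branch_point d : R := sup (range (fun n => cantor_left n d : R)).

Lemma branch_point_cyl d n : cyl n d (branch_point d).
Proof.
have ub N : ubound (range (fun n => cantor_left n d : R)) (cantor_left N d + (3 ^+ N)^-1).
  move=> _ [k _ <-]; have : cyl k d (cantor_left k d).
    by apply/cylE; rewrite lexx lerDl ltW// pow3V_gt0.
  have [Nk|/ltnW kN] := leqP N k; first by move=> /(cyl_sub Nk)/cylE/andP[].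
  move=> _; apply: le_trans (_ : cantor_left N d <= _); last by rewrite lerDl ltW// pow3V_gt0.
  have : cyl N d (cantor_left N d) by apply/cylE; rewrite lexx lerDl ltW// pow3V_gt0.
  by move=> /(cyl_sub kN)/cylE/andP[].
have hs : has_sup (range (fun n => cantor_left n d : R)).
  by split; [exists (cantor_left 0 d), 0%N|exists (cantor_left 0 d + (3 ^+ 0)^-1); exact: ub].
apply/cylE/andP; split; first by apply: ub_le_sup; [case: hs|exists n].
by apply: ge_sup; [case: hs|exact: ub].
Qed.

Lemma cyl_torus n d x : cyl n d x -> x != 1 -> torus x.
Proof.
move=> /cylE/andP[h1 h2] x1; have [? ?] := cantor_left_bounds n d.
by rewrite /torus/= in_itv/=; apply/andP; split; [lra|rewrite lt_neqAle x1; lra].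
Qed.

(** A first digit [false] keeps the point in [[0, 1/3]], away from [1], which the representatives
    [[0, 1[] of the torus exclude. *)
Lemma branch_point_K d : d 0%N = false -> Kset (branch_point d).
Proof.
move=> d0; split; first by rewrite cantor_setE => n; exists d; exact: branch_point_cyl.
apply: (@cyl_torus 1 d); first exact: branch_point_cyl.
have/cylE := branch_point_cyl d 1.
rewrite cantor_leftS cantor_left0 d0 mul0r expr1 => /andP[? ?].
by apply/negP => /eqP e; lra.
Qed.

Lemma dT_torus x y : torus x -> torus y -> dT x y = Num.min `|x - y| (1 - `|x - y|).
Proof.
rewrite /torus/= !in_itv/= => /andP[x0 x1] /andP[y0 y1]; rewrite /dT /fracR.
have [xy|xy] := leP y x.
  rewrite (_ : Num.floor (x - y) = 0) ?subr0 ?ger0_norm ?subr_ge0//.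
  by apply: floor_def; rewrite add0r; apply/andP; split; lra.
rewrite (_ : Num.floor (x - y) = -1); last first.
  by apply: floor_def; rewrite addNr; apply/andP; split; lra.
rewrite ltr0_norm ?subr_lt0// minC; congr Num.min; lra.
Qed.

(** Together with [dT_attained], this makes [dT] the minimum of [|x - y + k|] over integers [k];
    symmetry and the triangle inequality then need no fractional parts. *)
Lemma dT_le_dist x y (k : int) : dT x y <= `|x - y + k%:~R|.
Proof.
rewrite /dT /fracR; set f := Num.floor _.
have f1 : f%:~R <= x - y by exact: floor_le_tmp.
have f2 : x - y < f%:~R + 1 by have := floorD1_gt (x - y); rewrite intrD.
rewrite ge_min; have [kf|kf] := leP (- f) k.
  have : (- f)%:~R <= k%:~R :> R by rewrite ler_int.
  by rewrite mulrNz => ?; rewrite ger0_norm; lra.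
have : (k + 1)%:~R <= (- f)%:~R :> R by rewrite ler_int; lia.
by rewrite intrD mulrNz => ?; rewrite ler0_norm; lra.
Qed.

Lemma dT_attained x y : exists k : int, dT x y = `|x - y + k%:~R|.
Proof.
rewrite /dT /fracR; set f := Num.floor _.
have f1 : f%:~R <= x - y by exact: floor_le_tmp.
have f2 : x - y < f%:~R + 1 by have := floorD1_gt (x - y); rewrite intrD.
case: (leP (x - y - f%:~R)) => _.
  by exists (- f); rewrite mulrNz ger0_norm//; lra.
by exists (- f - 1); rewrite intrD !mulrNz ler0_norm; lra.
Qed.

Lemma dT_le x y : dT x y <= `|x - y|.
Proof. by have := dT_le_dist x y 0; rewrite addr0. Qed.

Lemma dT_ge0 x y : 0 <= dT x y.
Proof. by have [k ->] := dT_attained x y. Qed.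

Lemma dT_le1 x y : dT x y <= 1.
Proof.
rewrite /dT /fracR ge_min; apply/orP; left.
by have := floorD1_gt (x - y); rewrite intrD; lra.
Qed.

Lemma dTC x y : dT x y = dT y x.
Proof.
wlog suff : x y / dT x y <= dT y x by move=> H; apply/eqP; rewrite eq_le !H.
have [k ->] := dT_attained y x; have := dT_le_dist x y (- k).
by rewrite (_ : x - y + _ = - (y - x + k%:~R)) ?normrN// mulrNz; ring.
Qed.

Lemma dT_triangle z x y : dT x y <= dT x z + dT z y.
Proof.
have [k ->] := dT_attained x z; have [l ->] := dT_attained z y.
apply: le_trans (dT_le_dist x y (k + l)) _; rewrite intrD.
by apply: le_trans (ler_normD _ _); rewrite le_eqVlt; apply/orP; left; apply/eqP; congr `|_|; ring.
Qed.

End Cantor.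

(** * Mass distribution on the binary tree *)

Section Tree.
Context {R : realType}.
Variables (adm : seq bool -> Prop) (free : pred nat) (m : nat -> R).
Hypothesis m_gt0 : forall n, 0 < m n.
Hypothesis mS : forall n, m n.+1 = if free n then m n / 2 else m n.
Hypothesis adm_nil : adm [::].
Hypothesis adm_rcons : forall u, adm u -> exists c, adm (rcons u c).
Hypothesis adm_free : forall u c, adm u -> free (size u) -> adm (rcons u c).

(* The greedy choice of the child of smaller relative load replaces the mass
   distribution principle: [m] is the mass of an admissible word and [load u]
   bounds the mass of the words [Q i] lying below [u]. *)
Lemma branch_avoiding (Q : nat -> seq bool) :
  (\sum_(i <oo) (m (size (Q i)))%:E < (m 0)%:E)%E ->
  exists omega : nat -> bool, (forall n, adm (mkseq omega n)) /\
    forall i, mkseq omega (size (Q i)) != Q i.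
Proof.
move=> Qm.
pose w u i : R := if prefix u (Q i) then m (size (Q i)) else 0.
pose load u := (\sum_(i <oo) (w u i)%:E)%E.
have w_ge0 u i : (0 <= (w u i)%:E)%E by rewrite lee_fin /w; case: ifP => // _; apply/ltW.
have load_ge0 u : (0 <= load u)%E by apply: nneseries_ge0.
pose ok u := adm u /\ (load u < (m (size u))%:E)%E.
have w_rcons u c i : w (rcons u c) i <= w u i.
  rewrite /w; case: ifP => [h|_]; last by case: ifP => // _; apply/ltW.
  by rewrite (prefix_trans (prefix_rcons _ _) h).
have step u : exists c, ok u -> ok (rcons u c).
  have [[au lu]|nok] := pselect (ok u); last by exists true.
  have le_load c : (load (rcons u c) <= load u)%E.
    by apply: lee_nneseries => // i _; rewrite lee_fin.
  case fu : (free (size u)); last first.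
    have [c ac] := adm_rcons au; exists c => _; split=> //.
    by rewrite size_rcons mS fu; apply: le_lt_trans lu.
  (* No word lies below both children, so the loads add up to at most that of [u], and one child
     gets less than half the mass. *)
  have two : (load (rcons u true) + load (rcons u false) <= load u)%E.
    rewrite -nneseriesD//; apply: lee_nneseries => i *; first exact: adde_ge0.
    rewrite -EFinD lee_fin.
    have [h|h] := boolP (prefix (rcons u true) (Q i)); last first.
      by rewrite {1}/w (negbTE h) add0r.
    rewrite {2}/w; case: ifP => [h'|_]; last by rewrite addr0.
    by move: h h'; rewrite !prefixE !size_rcons => /eqP -> /eqP /rcons_inj.
  suff [c hc] : exists c, (load (rcons u c) < (m (size u) / 2)%:E)%E.
    by exists c => _; split; [exact: adm_free|rewrite size_rcons mS fu].
  have [h|h] := ltP (load (rcons u true)) (m (size u) / 2)%:E; first by exists true.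
  have [h'|h'] := ltP (load (rcons u false)) (m (size u) / 2)%:E; first by exists false.
  have := le_lt_trans (leeD h h') (le_lt_trans two lu).
  by rewrite -EFinD lte_fin -splitr ltxx.
have [f fP] := choice step.
pose W := fix W n := if n is n'.+1 then rcons (W n') (f (W n')) else [::].
have WE n : W n = mkseq (f \o W) n by elim: n => // n IH; rewrite mkseqS /= -IH.
have Wok n : ok (W n).
  elim: n => [|n IH]; last exact: fP.
  split=> //; apply: le_lt_trans Qm; apply: lee_nneseries => // i _.
  by rewrite lee_fin /w prefix0s.
exists (f \o W); split=> [n|i]; first by rewrite -WE; case: (Wok n).
(* If the branch ran through [Q i], its load there would include the term of [Q i] itself, already
   the full mass of that level. *)
rewrite -WE; apply/negP => /eqP e; have [_] := Wok (size (Q i)).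
rewrite e ltNge => /negP; apply.
apply: le_trans (nneseries_lim_ge i.+1 _) => //.
rewrite big_nat_recr//= [w _ i]/w prefix_refl leeDr//.
by apply: sume_ge0 => k _; exact: w_ge0.
Qed.

End Tree.

(** * Hausdorff measure and a mass distribution principle *)

Section Hausdorff.
Context {R : realType}.
Implicit Types (s D : R) (U A : set R).

Lemma has_ubound_dT U : has_ubound [set dT x y | x in U & y in U].
Proof. by exists 1 => _ [x _ [y _ <-]]; exact: dT_le1. Qed.

Lemma dT_le_diamT U x y : U x -> U y -> dT x y <= diamT U.
Proof.
by move=> Ux Uy; apply: ub_le_sup; [exact: has_ubound_dT|exists x => //; exists y].
Qed.

Lemma diamT_le U D : 0 <= D -> (forall x y, U x -> U y -> dT x y <= D) ->
  diamT U <= D.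
Proof.
move=> D0 UD; rewrite /diamT.
have [->|/set0P ne] := eqVneq [set dT x y | x in U & y in U] set0; first by rewrite sup0.
by apply: ge_sup => // _ [x Ux [y Uy <-]]; exact: UD.
Qed.

Lemma diamT_ge0 U : 0 <= diamT U.
Proof.
have [->|/set0P[x Ux]] := eqVneq U set0.
  rewrite /diamT (_ : [set _ | _ in _ & _ in _] = set0) ?sup0//.
  by apply/seteqP; split=> // _ [x []].
exact: le_trans (dT_ge0 x x) (dT_le_diamT Ux Ux).
Qed.

Lemma diam_pow_ge0 s U : 0 <= diam_pow s U.
Proof. by rewrite /diam_pow; case: ifP => // _; exact: powR_ge0. Qed.

Lemma diam_pow_le s U D : 0 <= s -> 0 <= D ->
  (forall x y, U x -> U y -> dT x y <= D) -> diam_pow s U <= D `^ s.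
Proof.
move=> s0 D0 UD; rewrite /diam_pow; case: ifP => _; first exact: powR_ge0.
by apply: ge0_ler_powR; rewrite ?nnegrE ?diamT_ge0//; exact: diamT_le.
Qed.

Lemma diam_pow_neq0 s U : diamT U != 0 -> diam_pow s U = diamT U `^ s.
Proof.
move=> U0; rewrite /diam_pow; case: asboolP => // U_0; move: U0.
by rewrite eq_le diamT_ge0 andbT U_0 diamT_le.
Qed.

Lemma hausdorff_approx_ge0 s delta A : (0 <= hausdorff_approx s delta A)%E.
Proof.
apply: le_ereal_inf_tmp => _ [U _ <-]; apply: nneseries_ge0 => i _ _.
by rewrite lee_fin diam_pow_ge0.
Qed.

Lemma hausdorff_approx_le s delta A (U : nat -> set R) :
  (forall i, U i `<=` torus) -> (forall i, diamT (U i) <= delta) ->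
  A `<=` \bigcup_i U i ->
  (hausdorff_approx s delta A <= \sum_(i <oo) (diam_pow s (U i))%:E)%E.
Proof. by move=> h1 h2 h3; apply: ereal_inf_lbound; exists U. Qed.

Lemma hausdorff_approx_le_measure s delta A : 0 < delta ->
  (hausdorff_approx s delta A <= hausdorff_measure s A)%E.
Proof. by move=> d0; apply: ereal_sup_ubound; exists delta. Qed.

Lemma hausdorff_measure_ge0 s A : (0 <= hausdorff_measure s A)%E.
Proof.
exact: le_trans (hausdorff_approx_ge0 _ _ _) (@hausdorff_approx_le_measure s 1 A ltr01).
Qed.

Lemma hausdorff_measure0_cover s A delta e : hausdorff_measure s A = 0%E ->
  0 < delta -> 0 < e -> exists U : nat -> set R,
  [/\ forall i, U i `<=` torus, forall i, diamT (U i) <= delta,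
    A `<=` \bigcup_i U i & (\sum_(i <oo) (diam_pow s (U i))%:E < e%:E)%E].
Proof.
move=> H0 d0 e0.
have : (hausdorff_approx s delta A < e%:E)%E.
  by rewrite (le_lt_trans (hausdorff_approx_le_measure _ _ d0))// H0 lte_fin.
by move=> /ereal_inf_lt[_ [U [h1 [h2 h3]] <-] h]; exists U.
Qed.

Lemma exprn_small (x e : R) : 0 <= x < 1 -> 0 < e -> exists n, x ^+ n < e.
Proof.
move=> /andP[x0 x1] e0; have : x ^+ n @[n --> \oo] --> (0 : R).
  by apply: cvg_expr; rewrite ger0_norm.
move=> /cvgrPdist_lt/(_ e e0)[N _ /(_ N (leqnn N))] /=.
by rewrite sub0r normrN ger0_norm ?exprn_ge0//; exists N.
Qed.

Lemma pow3V_powR n s : ((3 ^+ n)^-1 : R) `^ s = (3^-1 `^ s) ^+ n.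
Proof.
rewrite -exprVn -powR_mulrn ?invr_ge0// -powRrM mulrC powRrM powR_mulrn// powR_ge0.
Qed.

Lemma powR_third_lt1 s : 0 < s -> (3^-1 : R) `^ s < 1.
Proof.
move=> s0; have := @gt0_ltr_powR R s s0 3^-1 1.
by rewrite powR1 !nnegrE; apply; lra.
Qed.

Lemma pow3V_bracket D : 0 < D < 1 -> exists n, (3 ^+ n.+1)^-1 <= D < (3 ^+ n)^-1.
Proof.
move=> /andP[D0 D1].
have [|n nD] := @exprn_small 3^-1 D _ D0; first by lra.
have : exists n, (3 ^+ n)^-1 <= D by exists n; rewrite -exprVn ltW.
move=> /ex_minnP[[|k] kD min]; first by move: kD; rewrite expr0 invr1 leNgt D1.
exists k; rewrite kD/= ltNge; apply/negP => /min; by rewrite ltnn.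
Qed.

(** A cover with a small sum is turned into one word per covering set, of total mass below [m 0];
    [branch_avoiding] then gives a point of [A] outside the cover. Diameters are at most [1/3], so
    [diam^s' <= diam^s] and the exponent [s] may be smaller than [s']. *)
Lemma hausdorff_measure_branch_neq0 (adm : seq bool -> Prop) (free : pred nat)
    (m : nat -> R) (s s' C : R) A :
  (forall n, 0 < m n) ->
  (forall n, m n.+1 = if free n then m n / 2 else m n) ->
  adm [::] -> (forall u, adm u -> exists c, adm (rcons u c)) ->
  (forall u c, adm u -> free (size u) -> adm (rcons u c)) ->
  (forall u, adm u -> ~~ head false u) ->
  0 < C -> 0 < s' -> s <= s' ->
  (forall n, m n <= C * (3 ^+ n)^-1 `^ s') ->
  (forall omega, (forall n, adm (mkseq omega n)) -> A (branch_point omega)) ->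
  hausdorff_measure s A <> 0%E.
Proof.
move=> m0 mS a0 aS af ah C0 s'0 ss' mC Abr HA.
pose K0 := C * 3 `^ s'; have K0_gt0 : 0 < K0 by rewrite mulr_gt0// powR_gt0.
(* Half of the total mass is reserved for the diameters, the other half for the slack terms
   below. *)
have [||U [Ut Ud AU Us]] := @hausdorff_measure0_cover s A (3^-1) (m 0%N / 2 / K0) HA.
  by rewrite invr_gt0.
  by rewrite !divr_gt0.
(* The slack handles sets of diameter [0], for which [n] is just taken large. Otherwise the diameter
   is rounded up to a power of [1/3], at the cost of the factor [3^s'] in [K0]. *)
have /choice[n_ n_P] i : exists n, diamT (U i) < (3 ^+ n)^-1 /\
    m n <= K0 * diam_pow s (U i) + m 0%N / 2 / (2 ^ i.+1)%:R.
  have e0 : 0 < m 0%N / 2 / (2 ^ i.+1)%:R by rewrite !divr_gt0// ltr0n expn_gt0.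
  have [D0|D0] := eqVneq (diamT (U i)) 0.
    have [||n nD] := @exprn_small (3^-1 `^ s') (m 0%N / 2 / (2 ^ i.+1)%:R / C).
    - by rewrite powR_ge0 powR_third_lt1.
    - by rewrite divr_gt0.
    exists n; rewrite D0 pow3V_gt0; split=> //.
    apply: le_trans (mC n) _; rewrite pow3V_powR.
    rewrite (@le_trans _ _ (m 0%N / 2 / (2 ^ i.+1)%:R))//.
      by rewrite mulrC -ler_pdivlMr// ltW.
    by rewrite lerDr mulr_ge0 ?diam_pow_ge0// ltW.
  have Dgt0 : 0 < diamT (U i) by rewrite lt_neqAle eq_sym D0 diamT_ge0.
  have [|n /andP[n1 n2]] := @pow3V_bracket (diamT (U i)).
    by rewrite Dgt0/=; have := Ud i; lra.
  exists n; split=> //; apply: le_trans (mC n) _.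
  rewrite diam_pow_neq0// -[leLHS]addr0 lerD ?(ltW e0)//.
  rewrite -mulrA ler_pM2l//.
  apply: (@le_trans _ _ ((3 * diamT (U i)) `^ s')).
    apply: ge0_ler_powR; rewrite ?nnegrE ?(ltW s'0)//.
    - by rewrite mulr_ge0// ltW.
    - by rewrite pow3VS ler_pM2l.
  rewrite powRM ?(ltW Dgt0)// ler_pM2l ?powR_gt0//.
  by apply: ger_powR => //; rewrite Dgt0/=; have := Ud i; lra.
(* All admissible branch points in [U i] share a prefix of length [n_ i], the diameter being below
   [3^-(n_ i)]; if there are none, any word of that length serves. *)
have /choice[Q QP] i : exists q, size q = n_ i /\
    forall omega, (forall n, adm (mkseq omega n)) -> U i (branch_point omega) ->
    mkseq omega (n_ i) = q.
  have [[om [ao Uo]]|no] := pselect (exists om,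
      (forall n, adm (mkseq om n)) /\ U i (branch_point om)).
    exists (mkseq om (n_ i)); rewrite size_mkseq; split=> // om' ao' Uo'.
    have tors o1 : (forall n, adm (mkseq o1 n)) -> 
        Kset (branch_point o1 : R) /\ 0 <= (branch_point o1 : R) <= 3^-1.
      move=> /(_ 1%N)/ah /= /negbTE o10; split; first exact: branch_point_K.
      have /cylE := @branch_point_cyl R o1 1.
      by rewrite cantor_leftS cantor_left0 o10 expr1 mul0r !add0r.
    have [[_ t1] r1] := tors om ao; have [[_ t2] r2] := tors om' ao'.
    have lt_n : `|branch_point om' - branch_point om : R| < (3 ^+ n_ i)^-1.
      have := le_lt_trans (dT_le_diamT Uo' Uo) (n_P i).1.
      (* Both points lie in [[0, 1/3]], so the wrapped distance is never the shorter one. *)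
      rewrite dT_torus// gt_min => /orP[//|]; apply: le_lt_trans.
      have : `|branch_point om' - branch_point om : R| <= 3^-1; last by lra.
      by move: r1 r2 => /andP[? ?] /andP[? ?]; rewrite ler_norml; apply/andP; split; lra.
    apply/eq_in_map => k; rewrite mem_iota add0n => /andP[_ kn].
    exact: (cyl_sep (branch_point_cyl om' _) (branch_point_cyl om _) lt_n).
  exists (nseq (n_ i) false); rewrite size_nseq; split=> // om ao Uo; case: no.
  by exists om.
have [|om [ao oQ]] := branch_avoiding m0 mS a0 aS af (Q := Q).
  apply: (@le_lt_trans _ _ (\sum_(i <oo)
    ((K0 * diam_pow s (U i))%:E + (m 0%N / 2 / (2 ^ i.+1)%:R)%:E))%E).
    apply: lee_nneseries => [i _ _|i _]; first by rewrite lee_fin ltW.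
    by rewrite (QP i).1 -EFinD lee_fin (n_P i).2.
  apply: le_lt_trans (epsilon_trick _ _ _) _ => [i||].
  - by rewrite lee_fin mulr_ge0 ?diam_pow_ge0// ltW.
  - by rewrite ltW// divr_gt0.
  under eq_eseriesr do rewrite EFinM.
  rewrite nneseriesZl; last by move=> i _; rewrite lee_fin diam_pow_ge0.
  rewrite [X in (_ < X%:E)%E](splitr (m 0%N)) EFinD lte_leD//.
  rewrite (_ : m 0%N / 2 = K0 * (m 0%N / 2 / K0)); last by rewrite mulrCA divff ?mulr1 ?gt_eqF.
  by rewrite [ltRHS]EFinM lte_pmul2l// lte_fin.
have [i _ Ui] := AU _ (Abr om ao).
by have := oQ i; rewrite (QP i).1 ((QP i).2 om ao Ui) eqxx.
Qed.

End Hausdorff.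

(** * The Hausdorff measure of the Cantor set *)

Section CantorMeasure.
Context {R : realType}.

Lemma ln2_gt0 : 0 < ln 2 :> R. Proof. by rewrite ln_gt0// ltr1n. Qed.

Lemma ln3_gt0 : 0 < ln 3 :> R. Proof. by rewrite ln_gt0// ltr1n. Qed.

Lemma kappa_gt0 : 0 < kappa :> R.
Proof. by rewrite divr_gt0 ?ln2_gt0 ?ln3_gt0. Qed.

Lemma kappa_lt1 : kappa < 1 :> R.
Proof. by rewrite ltr_pdivrMr ?ln3_gt0// mul1r ltr_ln ?posrE// ltr_nat. Qed.

Lemma powR3_kappa : 3 `^ kappa = 2 :> R.
Proof.
by rewrite /powR gt_eqF// /kappa divfK ?lnK ?posrE// gt_eqF// ln3_gt0.
Qed.

Lemma pow3V_kappa n : (3 ^+ n)^-1 `^ kappa = (2 ^+ n)^-1 :> R.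
Proof.
rewrite pow3V_powR -powR_inv1// powRAC powR3_kappa powR_inv1//.
by rewrite exprVn.
Qed.

Definition words n : seq (n.-tuple bool) := enum {: n.-tuple bool}.

Lemma size_words n : size (words n) = (2 ^ n)%N.
Proof. by rewrite /words -cardE card_tuple card_bool. Qed.

Definition wcyl n (w : n.-tuple bool) : set R := cyl n (nth false w).

Lemma cyl_wcyl n d : exists w : n.-tuple bool,
  (forall i, (i < n)%N -> nth false w i = d i) /\ wcyl w = cyl n d.
Proof.
exists (mktuple (fun i : 'I_n => d i)).
have e i : (i < n)%N -> nth false (mktuple (fun i : 'I_n => d i)) i = d i.
  by move=> h; rewrite -[i]/(val (Ordinal h)) -tnth_nth tnth_mktuple.
by split => //; exact: eq_cyl.
Qed.

Lemma cantor_set_wcyl (x : R) n : cantor_set x -> exists w : n.-tuple bool, wcyl w x.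
Proof.
rewrite cantor_setE => /(_ n)[d dx]; have [w [_ wE]] := cyl_wcyl n d.
by exists w; rewrite wE.
Qed.

Lemma measurable_cyl n d : measurable (cyl n d : set R).
Proof. exact: measurable_itv. Qed.

Lemma measurable_Kset : measurable (Kset : set R).
Proof.
apply: measurableI; last exact: measurable_itv.
rewrite (_ : cantor_set = \bigcap_n \bigcup_(w in [set` words n]) wcyl w).
  apply: bigcapT_measurable => n; rewrite bigcup_seq.
  by apply: bigsetU_measurable => w _; exact: measurable_cyl.
apply/seteqP; split=> [x Cx n _|x Hx].
  have [w wx] := cantor_set_wcyl n Cx; exists w => //=.
  by rewrite mem_enum.
rewrite cantor_setE => n; have [w _ wx] := Hx n I.
by exists (nth false w).
Qed.

(** The [2^n] cylinders of level [n] each contribute at most [(3^-n)^kappa = 2^-n]. *)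
Lemma hausdorff_measure_Kset_le1 : (hausdorff_measure kappa (Kset : set R) <= 1)%E.
Proof.
apply: ge_ereal_sup => _ [delta /= d0 <-].
have [|n nd] := @exprn_small R 3^-1 delta _ d0; first by lra.
pose w0 : n.-tuple bool := [tuple of nseq n false].
(* The sequence is padded with empty sets, which [diam_pow] counts as [0]. *)
pose U i : set R := if (i < 2 ^ n)%N then
  wcyl (nth w0 (words n) i) `&` torus else set0.
have Udist i x y : U i x -> U i y -> dT x y <= (3 ^+ n)^-1.
  rewrite /U; case: ifP => // _ [/cylE/andP[? ?] _] [/cylE/andP[? ?] _].
  by apply: le_trans (dT_le x y) _; rewrite ler_norml; apply/andP; split; lra.
apply: le_trans (@hausdorff_approx_le _ _ _ _ U _ _ _) _.
- by move=> i; rewrite /U; case: ifP => // _ x [].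
- move=> i; apply: le_trans (diamT_le _ (Udist i)) _; first by rewrite ltW// pow3V_gt0.
  by rewrite -exprVn ltW.
- move=> x [Cx tx]; have [w wx] := cantor_set_wcyl n Cx.
  have wi : (index w (words n) < size (words n))%N by rewrite index_mem mem_enum.
  exists (index w (words n)) => //; rewrite /U -size_words wi nth_index ?mem_enum//.
rewrite (@nneseries_split _ _ 0 (2 ^ n)); last by move=> k _; rewrite lee_fin diam_pow_ge0.
rewrite add0n [X in (_ + X)%E]eseries0 ?adde0; last first.
  move=> i ni _; rewrite /U ltnNge ni /= /diam_pow.
  by case: asboolP.
apply: (@le_trans _ _ (\sum_(0 <= k < 2 ^ n) ((2 ^+ n)^-1 : R)%:E)%E).
  apply: lee_sum => i _; rewrite lee_fin -pow3V_kappa.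
  apply: diam_pow_le; first exact/ltW/kappa_gt0.
    by rewrite ltW// pow3V_gt0.
  exact: Udist.
by rewrite sumEFin lee_fin sumr_const_nat subn0 -[_ *+ (2 ^ n)%N]mulr_natl natrX mulfV ?expf_neq0.
Qed.

Lemma hausdorff_measure_Kset_neq0 : hausdorff_measure kappa (Kset : set R) <> 0%E.
Proof.
(* Unit mass on the left half of the tree: the first digit is forced to be [false] and all later
   levels are free, whence [2^-(n-1)], with the truncated predecessor giving [1] at level [0]. *)
apply: (@hausdorff_measure_branch_neq0 R (fun u => ~~ head false u) (fun n => n != 0%N)
  (fun n => 2 ^- n.-1) kappa kappa 2) => //.
- by case=> [|n] //=; rewrite exprS invfM mulrC.
- by case=> [|c u] h; exists false.
- by case=> [|c u].
- exact: kappa_gt0.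
- case=> [|n]; rewrite pow3V_kappa /= ?expr0 ?invr1 ?mulr1 ?ler1n//.
  by rewrite exprS invfM mulrA mulfV// mul1r.
- by move=> omega /(_ 1%N)/= /negbTE; exact: branch_point_K.
Qed.

Lemma hausdorff_measure_Kset_gt0 : (0 < hausdorff_measure kappa (Kset : set R))%E.
Proof.
rewrite lt0e hausdorff_measure_ge0 andbT; apply/eqP; exact: hausdorff_measure_Kset_neq0.
Qed.

Lemma hausdorff_measure_Kset_fin : hausdorff_measure kappa (Kset : set R) \is a fin_num.
Proof.
rewrite ge0_fin_numE ?hausdorff_measure_ge0//.
exact: le_lt_trans hausdorff_measure_Kset_le1 (ltry _).
Qed.

(** [dT] depends on the difference only, so a cover of [B] pulls back along the translation without
    increasing diameters. Intersecting with [A] keeps the pulled-back sets in the torus. *)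
Lemma hausdorff_measure_shift_le (s t : R) (A B : set R) : 0 <= s -> A `<=` torus ->
  (forall x, A x -> B (x + t)) -> (hausdorff_measure s A <= hausdorff_measure s B)%E.
Proof.
move=> s0 At AB; apply: ge_ereal_sup => _ [delta /= d0 <-].
apply: le_trans (hausdorff_approx_le_measure _ _ d0).
apply: le_ereal_inf_tmp => _ [U [Ut [Ud BU]] <-].
pose V i : set R := A `&` [set x | U i (x + t)].
have VU i : diamT (V i) <= diamT (U i).
  apply: diamT_le; first exact: diamT_ge0.
  move=> x y [_ Ux] [_ Uy]; rewrite (_ : dT x y = dT (x + t) (y + t)).
    exact: dT_le_diamT.
  by rewrite /dT (_ : x + t - (y + t) = x - y)//; ring.
apply: le_trans (@hausdorff_approx_le _ _ _ _ V _ _ _) _.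
- by move=> i x [/At].
- by move=> i; apply: le_trans (VU i) (Ud i).
- by move=> x Ax; have [i _ Ui] := BU _ (AB _ Ax); exists i.
apply: lee_nneseries => [i _ _|i _]; first by rewrite lee_fin diam_pow_ge0.
rewrite lee_fin /diam_pow; case: asboolP => [_|Vi0]; first by case: ifP => // _; exact: powR_ge0.
case: asboolP => [U0|_]; first by case: Vi0; rewrite /V U0; apply/seteqP; split=> // x [].
by apply: ge0_ler_powR => //; rewrite nnegrE diamT_ge0.
Qed.

End CantorMeasure.

(** * Union bound and the normalized Hausdorff law on [K] *)

Lemma measure_bigcup_seq_le {d : measure_display} {T : measurableType d} {R : realType}
    (mu : {measure set T -> \bar R}) (I : choiceType) (s : seq I) (A : I -> set T) :
  (forall i, measurable (A i)) ->
  (mu (\bigcup_(i in [set` s]) A i) <= \sum_(i <- s) mu (A i))%E.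
Proof.
move=> mA; rewrite bigcup_seq; elim: s => [|i s IH]; first by rewrite !big_nil measure0.
rewrite !big_cons; apply: le_trans (leeD2l _ IH).
by apply: measureU2 => //; exact: bigsetU_measurable.
Qed.

Lemma probability_fin {d : measure_display} {T : measurableType d} {R : realType}
  (P : probability T R) (A : set T) : measurable A -> P A \is a fin_num.
Proof.
move=> mA; rewrite ge0_fin_numE ?measure_ge0//.
exact: le_lt_trans (probability_le1 P mA) (ltry _).
Qed.

Section CantorLaw.
Context {R : realType} {d : measure_display} {Omega : measurableType d}.
Variables (P : probability Omega R) (Y : Omega -> R).
Hypothesis mY : measurable_fun setT Y.
Hypothesis law : forall B : set R, measurable B ->
  (P (Y @^-1` B) * hausdorff_measure kappa Kset = hausdorff_measure kappa (B `&` Kset))%E.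

Lemma measurable_preimage (B : set R) : measurable B -> measurable (Y @^-1` B).
Proof. by move=> mB; rewrite -[_ @^-1` _]setTI; exact: mY. Qed.

(** The law is stated as a product; the factor cancels because the Hausdorff measure of [K] is
    positive and finite. *)
Lemma law_Kset : P (Y @^-1` Kset) = 1%E.
Proof.
have := law measurable_Kset; rewrite setIid -[RHS]mul1e => /eqP.
have f := @hausdorff_measure_Kset_fin R; have g := @hausdorff_measure_Kset_gt0 R.
move: f g; case: (hausdorff_measure _ _) => // h _; rewrite lte_fin => h0.
have : P (Y @^-1` Kset) \is a fin_num.
  exact: probability_fin (measurable_preimage measurable_Kset).
by move/fineK => <-; rewrite -!EFinM eqe => /eqP /(mulIf (lt0r_neq0 h0)) ->.
Qed.

Lemma law_le (A B : set R) (t : R) : measurable A -> measurable B ->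
  (forall x, A x -> Kset x -> B (x + t) /\ Kset (x + t)) ->
  (P (Y @^-1` A) <= P (Y @^-1` B))%E.
Proof.
move=> mA mB AB.
rewrite -(@lee_pmul2r _ (hausdorff_measure kappa Kset)) ?hausdorff_measure_Kset_fin ?hausdorff_measure_Kset_gt0//.
rewrite !law//; apply: (@hausdorff_measure_shift_le _ _ t).
- exact/ltW/kappa_gt0.
- by move=> x [_ []].
- by move=> x [Ax Kx]; exact: AB.
Qed.

(* The cylinders of level [n+1] are all translates of the leftmost one, except
   that [1], identified with [0], is missing from the last; hence comparison
   with the leftmost cylinder of level [n+1] inside a cylinder of level [n]. *)
Lemma law_cyl n dd : (((2 ^+ n.+1)^-1 : R)%:E <= P (Y @^-1` cyl n dd))%E.
Proof.
set z : nat -> bool := fun=> false.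
have zero k : cantor_left k z = 0 :> R by apply: big1 => i _; rewrite mul0r.
apply: (@le_trans _ _ (P (Y @^-1` cyl n.+1 z))); last first.
  apply: (@law_le _ _ (cantor_left n dd)); [exact: measurable_cyl|exact: measurable_cyl|].
  move=> x x0 [Cx tx].
  have xC : cantor_set (x + cantor_left n dd) by exact: cantor_set_shift_up Cx x0.
  have p := @pow3V_gt0 R n.+1; have e := @pow3VS R n.
  have [? ?] := @cantor_left_bounds R n dd.
  move: x0 => /cylE; rewrite zero => /andP[? ?].
  split; first by apply/cylE/andP; split; lra.
  by split=> //; rewrite /torus /= in_itv/=; apply/andP; split; lra.
have le0 (w : n.+1.-tuple bool) : (P (Y @^-1` wcyl w) <= P (Y @^-1` cyl n.+1 z))%E.
  apply: (@law_le _ _ (- cantor_left n.+1 (nth false w)));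
    [exact: measurable_cyl|exact: measurable_cyl|].
  move=> x xw [Cx tx].
  have xC := cantor_set_shift_down Cx xw.
  have [? ?] := @cantor_left_bounds R n.+1 (nth false w).
  move: xw => /cylE/andP[? ?].
  split; first by apply/cylE; rewrite zero; apply/andP; split; lra.
  split=> //; move: tx; rewrite /torus/= !in_itv/= => /andP[? ?].
  by apply/andP; split; lra.
(* The [2^(n+1)] cylinders cover [K], of probability one, and none outweighs the leftmost. *)
have one_le : (1 <= \sum_(w <- words n.+1) P (Y @^-1` wcyl w))%E.
  have mW w : measurable (Y @^-1` @wcyl R n.+1 w).
    exact: measurable_preimage (measurable_cyl _ _).
  rewrite -law_Kset; apply: le_trans (measure_bigcup_seq_le _ _ mW).
  apply: le_measure; rewrite ?inE.
  - exact: measurable_preimage measurable_Kset.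
  - by rewrite bigcup_seq; apply: bigsetU_measurable => w _; exact: mW.
  move=> x [Cx _]; have [w wx] := cantor_set_wcyl n.+1 Cx.
  by exists w => //=; rewrite mem_enum.
have := le_trans one_le (lee_sum (words n.+1) (fun w _ => le0 w)).
have fin : P (Y @^-1` cyl n.+1 z) \is a fin_num.
  exact: probability_fin (measurable_preimage (measurable_cyl _ _)).
rewrite -(fineK fin).
rewrite sumEFin !lee_fin big_const_seq count_predT size_words iter_addr_0.
rewrite -[_ *+ (2 ^ _)%N]mulr_natl natrX => h.
by rewrite -[leLHS]mul1r ler_pdivrMr ?exprn_gt0// mulrC.
Qed.

End CantorLaw.

(** * Covering of the Cantor set by the random points *)

Section Codes.

Fixpoint code n (d : nat -> bool) : nat :=
  if n is n'.+1 then (3 * code n' d + 2 * d n')%N else 0%N.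

Lemma code_lt n d : (code n d < 3 ^ n)%N.
Proof. by elim: n => //= n IH; rewrite expnS; case: (d n); lia. Qed.

Context {R : realType}.

Lemma cantor_left_code n d : cantor_left n d = (code n d)%:R / 3 ^+ n :> R.
Proof.
elim: n => [|n IH]; first by rewrite cantor_left0 mul0r.
rewrite cantor_leftS IH /= natrD !natrM exprS.
by field; rewrite ?expf_neq0.
Qed.

Lemma cantor_set_cantor_left n d : cantor_set (cantor_left n d : R).
Proof.
have zero k : cyl k (fun=> false) (0 : R).
  have -> : 0 = cantor_left k (fun=> false) :> R by rewrite /cantor_left big1// => i _; rewrite mul0r.
  by apply/cylE; rewrite lexx lerDl ltW// pow3V_gt0.
rewrite -[cantor_left n d]add0r; apply: (@cantor_set_shift_up _ n n) => //.
by rewrite cantor_setE => k; exists (fun=> false).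
Qed.

(** Numerators of the left ends at level [n + 1] whose last ternary digit is [2]: they are prime to
    [3], hence admissible indices, and make up half of all left ends. *)
Definition left_codes n : seq nat :=
  [seq (3 * code n (nth false w) + 2)%N | w : n.-tuple bool <- words n].

Lemma size_left_codes n : size (left_codes n) = (2 ^ n)%N.
Proof. by rewrite size_map size_words. Qed.

Lemma uniq_left_codes n : uniq (left_codes n).
Proof.
rewrite map_inj_uniq ?enum_uniq// => w w' /addIn /eqP; rewrite eqn_mul2l/= => /eqP ww'.
have cyl_left (v : n.-tuple bool) : wcyl v (cantor_left n (nth false v) : R).
  by apply/cylE; rewrite lexx lerDl ltW// pow3V_gt0.
apply: eq_from_tnth => i; rewrite !(tnth_nth false).
apply: (cyl_agree (leqnn n) (cyl_left w)) => //.
by rewrite cantor_left_code ww' -cantor_left_code; exact: cyl_left.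
Qed.

Lemma left_codes_KjK m j n k : (m * j)%N = n.+1 -> k \in left_codes n ->
  @KjK R (3 ^ m) j k.
Proof.
move=> mj /mapP[w _ ->].
pose d i := if (i < n)%N then nth false w i else true.
have cd p : (p <= n)%N -> code p d = code p (nth false w).
  by elim: p => //= p IH pn; rewrite IH 1?ltnW// /d pn.
have E : (3 * code n (nth false w) + 2)%N = code n.+1 d by rewrite /= cd// /d ltnn.
have lt := code_lt n.+1 d.
rewrite /KjK /Kj -expnM mj; split.
  split; first by rewrite E.
  by rewrite coprimeXr// -coprime_modl -modnDml mulnC modnMl.
rewrite E natrX -cantor_left_code; split; first exact: cantor_set_cantor_left.
rewrite /torus /= in_itv/= cantor_left_code divr_ge0 ?exprn_ge0//=.
by rewrite ltr_pdivrMr ?exprn_gt0// mul1r -natrX ltr_nat.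
Qed.

(** An interval [[c, c + 1] / 3^n] contains only two multiples of [3^-n], so a point [k / 3^n] of
    [K] is an end of a cylinder of level [n]. *)
Definition all_codes n : seq nat :=
  [seq code n (nth false w) | w : n.-tuple bool <- words n] ++
  [seq (code n (nth false w)).+1 | w : n.-tuple bool <- words n].

Lemma size_all_codes n : size (all_codes n) = (2 * 2 ^ n)%N.
Proof. by rewrite size_cat 2!size_map size_words mul2n addnn. Qed.

Lemma KjK_all_codes m j k : @KjK R (3 ^ m) j k -> k \in all_codes (m * j).
Proof.
rewrite /KjK -expnM; set n := (m * j)%N => -[_ [Ck _]].
have [w] := cantor_set_wcyl n Ck.
move=> /cylE; rewrite cantor_left_code natrX -[X in _ + X]mul1r -mulrDl.
rewrite !ler_pM2r ?invr_gt0 ?exprn_gt0// natr1 !ler_nat => /andP[h1 h2].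
rewrite mem_cat; apply/orP.
have [e|e] := eqVneq k (code n (nth false w)).
  by left; apply/mapP; exists w; rewrite ?mem_enum.
by right; apply/mapP; exists w; rewrite ?mem_enum//; lia.
Qed.

End Codes.

Lemma prode_le {R : realType} (I : eqType) (s : seq I) (f : I -> \bar R) (c : R) :
  0 <= c -> (forall i, (0 <= f i)%E) -> (forall i, i \in s -> (f i <= c%:E)%E) ->
  (\prod_(i <- s) f i <= (c ^+ size s)%:E)%E.
Proof.
move=> c0 f0; elim: s => [|i s IH] fc; first by rewrite big_nil.
rewrite big_cons /= exprS EFinM; apply: lee_pmul => //.
- by elim/big_ind : _ => // x y; exact: mule_ge0.
- by apply: fc; rewrite mem_head.
- by apply: IH => k ks; apply: fc; rewrite in_cons ks orbT.
Qed.

(* With [u = 2^(mi)], the bound is [u^q (1 - 1/(2 u^q))^(u^(q+1)/2)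
   <= u^q exp(- u/4)]. *)
Lemma miss_bound {R : realType} (m q i n : nat) : (0 < m)%N ->
  (m * (q.+1 * i))%N = n.+1 ->
  2 ^+ (m * q * i) * (1 - 2 ^- (m * q * i).+1) ^+ (2 ^ n) <=
  (q.+1)`!%:R * 4 ^+ q.+1 / 2 ^+ i :> R.
Proof.
move=> m0 E; set g := (m * q * i)%N.
pose u : R := 2 ^+ (m * i).
have u0 : 0 < u by rewrite exprn_gt0.
have un0 : u != 0 by exact: lt0r_neq0.
have uq : 2 ^+ g = u ^+ q :> R by rewrite /u -exprM /g; congr (_ ^+ _); lia.
have un : 2 ^+ n.+1 = u ^+ q.+1 :> R by rewrite /u -exprM -E; congr (_ ^+ _); lia.
have gt0 : 0 < 2 ^- g.+1 :> R by rewrite invr_gt0 exprn_gt0.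
have le1 : 2 ^- g.+1 <= 1 :> R by rewrite invf_le1 ?exprn_gt0// exprn_ege1// ler1n.
have h : (1 - 2 ^- g.+1) ^+ (2 ^ n) <= expR (- (u / 4)) :> R.
  apply: (@le_trans _ _ (expR (- 2 ^- g.+1) ^+ (2 ^ n))).
    by apply: lerXn2r; rewrite ?nnegrE ?expR_ge0 ?subr_ge0//; exact: expR_ge1Dx.
  rewrite -expRM_natl ler_expR natrX le_eqVlt; apply/orP; left; apply/eqP.
  have -> : 2 ^+ n = u ^+ q.+1 / 2 :> R by rewrite -un exprS mulrC mulKf.
  rewrite [2 ^+ g.+1]exprS uq exprS; field.
  by rewrite expf_neq0// gt_eqF.
(* A single Taylor term of the exponential, of degree [q + 1], beats the [u^q] cylinders. *)
have h2 : expR (- (u / 4)) <= (q.+1)`!%:R * 4 ^+ q.+1 / u ^+ q.+1.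
  have u4 : 0 < u / 4 by rewrite divr_gt0.
  have -> : (q.+1)`!%:R * 4 ^+ q.+1 / u ^+ q.+1 = ((u / 4) ^+ q.+1 / (q.+1)`!%:R)^-1.
    by rewrite expr_div_n !invfM !invrK [RHS]mulrC [RHS]mulrA [RHS]mulrAC.
  rewrite expRN lef_pV2 ?posrE ?expR_gt0 ?divr_gt0 ?(exprn_gt0 _ u4) ?ltr0n ?fact_gt0//.
  by apply: le_trans (expR_ge1Dxn q (ltW u4)); rewrite lerDr.
rewrite uq; apply: (@le_trans _ _ (u ^+ q * ((q.+1)`!%:R * 4 ^+ q.+1 / u ^+ q.+1))).
  by rewrite ler_pM2l ?exprn_gt0//; exact: le_trans h h2.
have -> : u ^+ q * ((q.+1)`!%:R * 4 ^+ q.+1 / u ^+ q.+1) = (q.+1)`!%:R * 4 ^+ q.+1 / u.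
  by rewrite [u ^+ q.+1]exprS; field; rewrite ?un0 ?expf_neq0 ?un0.
rewrite ler_pM2l ?mulr_gt0 ?exprn_gt0 ?ltr0n ?fact_gt0//.
rewrite lef_pV2 ?posrE ?exprn_gt0// /u ler_weXn2l ?ler1n// leq_pmull//.
Qed.

Section Covering.
Context {R : realType} {d : measure_display} {Omega : measurableType d}.
Variables (P : probability Omega R) (m : nat) (Y : nat -> nat -> Omega -> R).
Hypothesis m_gt0 : (0 < m)%N.
Hypothesis mY : forall j k, measurable_fun setT (Y j k).
Hypothesis indY : mutually_independent P (idx (3 ^ m)) (fun jk => Y jk.1 jk.2).
Hypothesis lawK : forall j k, (1 <= j)%N -> @KjK R (3 ^ m) j k ->
  forall B : set R, measurable B ->
  (P (Y j k @^-1` B) * hausdorff_measure kappa Kset = hausdorff_measure kappa (B `&` Kset))%E.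

Definition missed (j g n : nat) : set Omega :=
  \bigcup_(w in [set` words g]) \bigcap_(k in [set` left_codes n]) (Y j k @^-1` ~` wcyl w).

Lemma measurable_missed j g n : measurable (missed j g n).
Proof.
rewrite /missed bigcup_seq; apply: bigsetU_measurable => w _.
rewrite bigcap_seq; apply: bigsetI_measurable => k _.
by apply: measurable_preimage; [exact: mY|apply: measurableC; exact: measurable_cyl].
Qed.

(** Union bound over the [2^g] cylinders; for each, independence gives a product of [2^n] factors,
    bounded through [law_cyl]. *)
Lemma missed_le j g n : (0 < j)%N -> (m * j)%N = n.+1 ->
  (P (missed j g n) <= (2 ^+ g * (1 - 2 ^- g.+1) ^+ (2 ^ n))%:E)%E.
Proof.
move=> j0 mj; rewrite /missed.
have mB w : measurable (\bigcap_(k in [set` left_codes n]) (Y j k @^-1` ~` @wcyl R g w)).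
  rewrite bigcap_seq; apply: bigsetI_measurable => k _.
  by apply: measurable_preimage; [exact: mY|apply: measurableC; exact: measurable_cyl].
apply: le_trans (measure_bigcup_seq_le _ _ mB) _.
apply: (@le_trans _ _ (\sum_(w <- words g) ((1 - 2 ^- g.+1) ^+ (2 ^ n) : R)%:E)%E); last first.
  rewrite sumEFin big_const_seq count_predT size_words iter_addr_0.
  by rewrite -[_ *+ (2 ^ _)%N]mulr_natl natrX.
apply: lee_sum => w _.
have := indY (s := [seq (j, k) | k <- left_codes n]) (B := fun=> ~` wcyl w).
rewrite big_map /= => ind.
rewrite (_ : \bigcap_(k in _) _ = \bigcap_(i in [set` [seq (j, k) | k <- left_codes n]])
  (Y i.1 i.2 @^-1` ~` wcyl w)); last first.
  apply/seteqP; split=> x Hx.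
    by move=> _ /= /mapP[k kn ->]; exact: Hx.
  by move=> k /= kn; apply: (Hx (j, k)) => /=; apply: map_f.
rewrite ind; first last.
- by move=> _; apply: measurableC; exact: measurable_cyl.
- move=> _ /mapP[k kn ->]; split=> //=; exact: (left_codes_KjK (R := R) mj kn).1.
- by rewrite map_inj_uniq ?uniq_left_codes// => ? ? [].
rewrite -(size_left_codes n); apply: prode_le.
- by rewrite subr_ge0 invf_le1 ?exprn_gt0// exprn_ege1// ler1n.
- by move=> k; exact: measure_ge0.
move=> k kn; have mC : measurable (Y j k @^-1` wcyl w).
  exact: measurable_preimage (measurable_cyl _ _).
rewrite preimage_setC probability_setC// -(fineK (probability_fin P mC)) -EFinB lee_fin.
rewrite lerD2l lerN2 -lee_fin fineK ?probability_fin//.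
exact: law_cyl (mY _ _) (lawK j0 (left_codes_KjK mj kn)) _ _.
Qed.

(* Only [P (missed ...) -> 0] is needed: no Borel-Cantelli, since we only ask
   for infinitely many good levels. *)
Lemma ae_covered : {ae P, forall x, forall q I : nat, exists i, [/\ (I < i)%N &
  forall dd, exists k, [/\ @KjK R (3 ^ m) (q.+1 * i) k, Kset (Y (q.+1 * i) k x) &
    cyl (m * q * i) dd (Y (q.+1 * i) k x)]]}.
Proof.
have aeK : {ae P, forall x, forall j k : nat, (0 < j)%N -> @KjK R (3 ^ m) j k -> Kset (Y j k x)}.
  apply: ae_foralln => j; apply: ae_foralln => k.
  have [[j0 kK]|no] := pselect ((0 < j)%N /\ @KjK R (3 ^ m) j k); last first.
    by apply: nearW => x j0 kK; case: no.
  have mK : measurable (Y j k @^-1` Kset) by exact: measurable_preimage measurable_Kset.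
  exists (~` (Y j k @^-1` Kset)); split; first exact: measurableC.
    change (P (~` (Y j k @^-1` Kset)) = 0%E).
    by rewrite probability_setC// (law_Kset (mY j k) (lawK j0 kK)) subee.
  by move=> x /= h Kx; apply: h => _ _.
have aeM : {ae P, forall x, forall q I : nat, exists i, (I < i)%N /\
    ~ missed (q.+1 * i) (m * q * i) (m * (q.+1 * i)).-1 x}.
  apply: ae_foralln => q; apply: ae_foralln => I.
  (* Failure beyond [I] is the intersection of all [M i], of probability at most each [P (M i)]. The
     shift makes every index exceed [I]. *)
  pose M i := missed (q.+1 * (I + i).+1) (m * q * (I + i).+1) (m * (q.+1 * (I + i).+1)).-1.
  have mM : measurable (\bigcap_i M i).
    by apply: bigcapT_measurable => i; exact: measurable_missed.
  exists (\bigcap_i M i); split=> //; last first.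
    move=> x /= /forallNP h i _; apply: contrapT => nM; apply: (h (I + i).+1).
    by rewrite ltnS leq_addr.
  have le i : (P (\bigcap_i M i) <= ((q.+1)`!%:R * 4 ^+ q.+1 / 2 ^+ (I + i).+1)%:E)%E.
    apply: (@le_trans _ _ (P (M i))).
      apply: le_measure; rewrite ?inE//; first exact: measurable_missed.
      by move=> x Hx; exact: Hx.
    have E : (m * (q.+1 * (I + i).+1))%N = (m * (q.+1 * (I + i).+1)).-1.+1.
      by rewrite prednK// !muln_gt0 m_gt0.
    apply: le_trans (missed_le _ _ E) _; first by rewrite muln_gt0.
    rewrite lee_fin; exact: miss_bound.
  change (P (\bigcap_i M i) = 0%E).
  have pK := fineK (probability_fin P mM).
  have p0 : 0 <= fine (P (\bigcap_i M i)) by exact: fine_ge0 (measure_ge0 _ _).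
  rewrite -pK; set p := fine _ in p0 pK *; suff -> : p = 0 by [].
  apply/eqP; rewrite eq_le p0 andbT leNgt; apply/negP => {}p0.
  set c : R := (q.+1)`!%:R * 4 ^+ q.+1 .
  have c0 : 0 < c by rewrite mulr_gt0 ?exprn_gt0 ?ltr0n ?fact_gt0.
  have [||n np] := @exprn_small R 2^-1 (p / c); first by lra.
    by rewrite divr_gt0.
  have := le n; rewrite -pK lee_fin leNgt => /negP; apply.
  apply: (@le_lt_trans _ _ (c / 2 ^+ n)).
    by rewrite ler_pM2l// lef_pV2 ?posrE ?exprn_gt0// ler_weXn2l ?ler1n//; lia.
  by rewrite mulrC -ltr_pdivlMr// -exprVn.
apply: filterS2 aeK aeM => x xK xM q I.
have [i [Ii nM]] := xM q I; exists i; split=> // dd.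
have qi0 : (0 < q.+1 * i)%N by rewrite muln_gt0 (leq_trans _ Ii).
have E : (m * (q.+1 * i))%N = (m * (q.+1 * i)).-1.+1.
  by rewrite prednK// muln_gt0 m_gt0.
have [w [_ wE]] := cyl_wcyl (R := R) (m * q * i) dd.
(* A cylinder without a suitable point would witness [missed]. *)
apply: contrapT => /forallNP no; apply: nM; exists w => /=; first by rewrite mem_enum.
move=> k /= kn wk; have kK := left_codes_KjK (R := R) E kn.
by apply: (no k); split=> //; [exact: xK|rewrite -wE].
Qed.

End Covering.

(** * Lower bound for the dimension *)

Section LowerBound.
Context {R : realType}.
Implicit Types (x y v e s : R).

Lemma infinite_fst (S : set (nat * nat)) :
  (forall J, exists j k, (J < j)%N /\ S (j, k)) -> ~ finite_set S.
Proof.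
move=> H /finite_seqP[l Sl].
have [j [k [Jj]]] := H (\max_(jk <- l) jk.1)%N.
rewrite Sl /= => jkl; move: Jj; rewrite ltnNge => /negP; apply.
exact: (@leq_bigmax_seq _ l xpredT (fun jk => jk.1) (j, k)).
Qed.

Lemma ltr_powR3 x y : x < y -> (3 : R) `^ x < 3 `^ y.
Proof. by move=> xy; rewrite /powR gt_eqF// ltr_expR ltr_pM2r// ln3_gt0. Qed.

Lemma pow3VE n : (3 ^+ n)^-1 = 3 `^ (- n%:R) :> R.
Proof. by rewrite powRN powR_mulrn. Qed.

Lemma radiusE (m j : nat) x :
  ((3 ^ m)%N%:R : R) `^ (- (x * j%:R)) = 3 `^ (- (m%:R * x * j%:R)).
Proof. by rewrite natrX -powR_mulrn// -powRrM mulrN -mulrA. Qed.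

Variables (m : nat) (y : nat -> nat -> R).
Hypothesis m_gt0 : (0 < m)%N.
Hypothesis covered : forall q I : nat, exists i, [/\ (I < i)%N &
  forall dd, exists k, [/\ @KjK R (3 ^ m) (q.+1 * i) k, Kset (y (q.+1 * i)%N k) &
    cyl (m * q * i) dd (y (q.+1 * i)%N k)]].

(** For [v = -e], the cylinder of level [m q i] around [xi] contains a point of generation
    [j = (q+1) i], at distance at most [b^-(q i)], which is below [b^-((1-e) j)] once [q] is
    large. *)
Lemma vbullet_ge0 xi : Kset xi -> (0 <= vbullet (3 ^ m) y xi)%E.
Proof.
move=> [Cxi txi]; apply/lee_addgt0Pr => e e0.
rewrite -[0%E]/(0%:E) -leeBlDr// -EFinB sub0r.
apply: ereal_sup_ubound; exists (- e) => //; split=> //; apply: infinite_fst => J.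
pose q := Num.truncn (e^-1).
have qe : 1 < e * q.+1%:R.
  rewrite mulrC -ltr_pdivrMr// div1r; exact: truncnS_gt.
have [i [Ji Hi]] := covered q J.
have /(_ (m * q * i)%N)[dd xid] : forall n, exists d, cyl n d xi by move: Cxi; rewrite cantor_setE.
have [k [kK yK yd]] := Hi dd.
exists (q.+1 * i)%N, k; split; first by rewrite (leq_trans Ji)// leq_pmull.
split=> /=.
  by split; [rewrite muln_gt0 (leq_trans _ Ji)|case: kK].
apply: le_lt_trans (dT_le _ _) _.
apply: (@le_lt_trans _ _ (3 ^- (m * q * i))).
  by move/cylE: xid => /andP[? ?]; move/cylE: yd => /andP[? ?];
    rewrite ler_norml; apply/andP; split; lra.
rewrite radiusE pow3VE; apply: ltr_powR3; rewrite ltrN2 !natrM.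
have i0 : 0 < i%:R :> R by rewrite ltr0n (leq_trans _ Ji).
have m0 : 0 < m%:R :> R by rewrite ltr0n.
rewrite -[ltLHS]mulrA -[ltRHS]mulrA ltr_pM2l// mulrA ltr_pM2r//.
by rewrite -natr1 in qe *; lra.
Qed.

Section Blocks.
Variables (v t : R) (q : nat).
Hypotheses (v_ge0 : 0 <= v) (t_gt0 : 0 < t) (t_lt1 : t < 1).
Hypothesis gap : 0 < q%:R - t * q.+1%:R * (v + 1).

(** With [j = (q+1) i]: [g i] is the level whose cylinders are to be hit by generation [j], and
    [h i] exceeds [m (v+1) j], so that [3^-(h i)] is below the radius [b^-((v+1) j)]. By [gap],
    [t (h i)] stays below [g i] for large [i]. *)
Let g i := (m * q * i)%N.
Let h i := (Num.truncn (m%:R * q.+1%:R * (v + 1) * i%:R)).+1.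

Lemma block_gh i : (g i < h i)%N.
Proof.
rewrite /h ltnS truncn_ge_nat ?mulr_ge0 ?addr_ge0//.
rewrite /g !natrM ler_wpM2r// -[leLHS]mulr1 ler_pM ?mulr_ge0 ?lerDr ?ler_wpM2l ?ler_nat//.
Qed.

(** Choosing [i] large compared with [H] makes the free levels from [H] to [g i] a proportion at
    least [t] of all levels up to [h i]. *)
Lemma block_next (H : nat) : exists i, [/\ (H < i)%N, (H <= g i)%N,
  t * (h i)%:R <= (g i)%:R - H%:R & forall dd, exists k,
    [/\ @KjK R (3 ^ m) (q.+1 * i) k, Kset (y (q.+1 * i)%N k) & cyl (g i) dd (y (q.+1 * i)%N k)]].
Proof.
set c : R := q%:R - t * q.+1%:R * (v + 1).
have c0 : 0 < c := gap.
(* The threshold comes from [t h <= g - m i c + t] with [t < 1]: it suffices that [i c > H + 1]. *)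
have [i [Ii Hi]] := covered q (maxn H (Num.truncn ((H%:R + 1) / c))).
have ic : H%:R + 1 < i%:R * c.
  rewrite -ltr_pdivrMr//; apply: lt_le_trans (truncnS_gt _) _.
  by rewrite ler_nat (leq_trans _ Ii)// ltnS leq_maxr.
have mi : i%:R * c <= m%:R * i%:R * c.
  by rewrite -mulrA ler_peMl ?mulr_ge0 ?(ltW c0)// ler1n.
have th : t * (h i)%:R <= (g i)%:R - H%:R.
  have hle : (h i)%:R <= m%:R * q.+1%:R * (v + 1) * i%:R + 1.
    by rewrite /h -natr1 lerD2r truncn_le !mulr_ge0// addr_ge0.
  apply: (@le_trans _ _ (t * (m%:R * q.+1%:R * (v + 1) * i%:R + 1))).
    by rewrite ler_pM2l.
  have -> : t * (m%:R * q.+1%:R * (v + 1) * i%:R + 1) =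
    m%:R * i%:R * q%:R - m%:R * i%:R * c + t by rewrite /c; ring.
  have -> : (g i)%:R = m%:R * i%:R * q%:R :> R by rewrite /g !natrM; ring.
  move: ic mi t_lt1.
  move: (m%:R * i%:R * c) (i%:R * c) (m%:R * i%:R * q%:R) => X1 X2 X3; lra.
exists i; split=> //; first by rewrite (leq_trans _ Ii)// ltnS leq_maxl.
rewrite -(ler_nat R) -subr_ge0; apply: le_trans th.
by rewrite mulr_ge0// ltW.
Qed.

Definition close i (dd : nat -> bool) := exists k,
  [/\ @KjK R (3 ^ m) (q.+1 * i) k, Kset (y (q.+1 * i)%N k) & cyl (h i) dd (y (q.+1 * i)%N k)].

Lemma close_Fb (i : nat -> nat) dd : (forall l, (l < i l)%N) ->
  torus (branch_point dd : R) ->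
  (forall l, close (i l) dd) -> Fb (3 ^ m) y v (branch_point dd).
Proof.
move=> li tor cl; split=> //; apply: infinite_fst => J.
have [k [kK yK yd]] := cl J; exists (q.+1 * i J)%N, k; split.
  by rewrite (leq_trans (li J))// leq_pmull.
split=> /=.
  by split; [rewrite muln_gt0 (leq_trans _ (li J))|case: kK].
apply: le_lt_trans (dT_le _ _) _.
apply: (@le_lt_trans _ _ (3 ^- h (i J))).
  move/cylE: (@branch_point_cyl R dd (h (i J))) => /andP[? ?].
  by move/cylE: yd => /andP[? ?]; rewrite ler_norml; apply/andP; split; lra.
rewrite radiusE pow3VE; apply: ltr_powR3; rewrite ltrN2 natrM.
rewrite (_ : m%:R * _ * _ = m%:R * q.+1%:R * (v + 1) * (i J)%:R); last by ring.
exact: truncnS_gt.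
Qed.

(** Mass is halved at free levels only. If [N n] counts them, then [t n <= N n + 1], so the mass
    [2^-(N n)] is at most [2 (3^-n)^(t kappa)], as the mass distribution principle requires. *)
Lemma Vbullet_measure_neq0 s : s <= t * kappa ->
  hausdorff_measure s (Vbullet (3 ^ m) y v `&` Kset) <> 0%E.
Proof.
move=> st; have [f fP] := choice block_next.
(* Starting at [1] leaves level [0] outside every block, so the first digit can be [false]. *)
pose Hs := fix Hs l := if l is l'.+1 then h (f (Hs l')) else 1%N.
pose G l := g (f (Hs l)).
have HG l : (Hs l <= G l)%N by have [] := fP (Hs l).
have GH l : (G l < Hs l.+1)%N by exact: block_gh.
have HsS l : (Hs l < Hs l.+1)%N by exact: leq_ltn_trans (HG l) (GH l).
have Hs_lt l : (l < Hs l)%N by elim: l => // l IH; exact: leq_ltn_trans IH (HsS l).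
have Hs_le l l' : (l <= l')%N -> (Hs l <= Hs l')%N.
  by apply: (@homo_leq _ Hs leq) => // [? ? ?|p]; [exact: leq_trans|exact: ltnW].
have li l : (l < f (Hs l))%N by have [hl _ _ _] := fP (Hs l); exact: ltn_trans hl.
(* Block [l] consists of the levels [Hs l <= p < Hs l.+1]: digits are free up to
   [G l] and forced from there on. *)
pose free p := `[< exists l, (Hs l <= p < G l)%N >].
pose N n := (\sum_(p < n) free p)%N.
have NS n : N n.+1 = (N n + free n)%N by rewrite /N big_ord_recr.
have N_le n k : (N n <= N (n + k))%N.
  by elim: k => [|k IH]; rewrite ?addn0// addnS NS (leq_trans IH)// leq_addr.
have NH l r : (r <= G l - Hs l)%N -> (N (Hs l + r) = N (Hs l) + r)%N.
  elim: r => [|r IH] rG; first by rewrite !addn0.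
  rewrite addnS NS IH 1?ltnW// (_ : free _ = true) ?addn1 ?addnS//.
  by apply/asboolP; exists l; rewrite leq_addr/=; lia.
(* On free levels the count grows by one per level, faster than [t n]. On forced levels the worst
   case is the end of the block, where its own free levels suffice by [block_next]. *)
have tN n : t * n%:R <= (N n)%:R + 1.
  suff H l : forall n, (n <= Hs l)%N -> t * n%:R <= (N n)%:R + 1.
    by apply: (H n); apply/ltnW/Hs_lt.
  elim: l => [|l IH] {}n nl.
    apply: (@le_trans _ _ 1); last by rewrite lerDr.
    by move: nl => /=; case: n => [|[|]]// _; rewrite ?mulr0 ?mulr1 ?ltW.
  have [/IH//|lt_n] := leqP n (Hs l).
  have [nG|Gn] := leqP n (G l).
    have -> : n = (Hs l + (n - Hs l))%N by lia.
    rewrite NH; last by lia.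
    rewrite !natrD mulrDr; have := IH _ (leqnn (Hs l)).
    have : t * (n - Hs l)%:R <= (n - Hs l)%:R by rewrite ler_piMl// ltW.
    lra.
  have [_ _ tg _] := fP (Hs l).
  have : t * n%:R <= t * (Hs l.+1)%:R by rewrite ler_pM2l// ler_nat.
  have : ((G l)%:R - (Hs l)%:R : R) <= (N n)%:R.
    rewrite -natrB// ler_nat.
    have -> : n = (G l + (n - G l))%N by lia.
    apply: leq_trans (N_le _ _).
    by rewrite -[in N _](subnKC (HG l)) NH// leq_addl.
  rewrite /G /= in tg *; lra.
(* Once [u] reaches the forced part of block [l], it must follow some branch that is close to a
   random point, up to the end of the block. *)
pose adm u := ~~ head false u /\ forall l, (G l <= size u)%N ->
  exists2 dd, close (f (Hs l)) dd &
  forall p, (p < size u)%N -> (p < Hs l.+1)%N -> nth false u p = dd p.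
(* The covering property: whatever the free digits, a suitable forced continuation exists. *)
have ext l dd : exists2 dd', close (f (Hs l)) dd' & forall p, (p < G l)%N -> dd p = dd' p.
  have [_ _ _ /(_ dd)[k [kK yK yd]]] := fP (Hs l).
  have : cantor_set (y (q.+1 * f (Hs l))%N k) by case: yK.
  rewrite cantor_setE => /(_ (h (f (Hs l))))[d' d'y].
  exists d'; first by exists k.
  by apply: (cyl_agree _ yd d'y); exact/ltnW/block_gh.
have adm_step u c : adm u -> (size u = 0%N -> c = false) ->
    (forall l, (G l <= size u < Hs l.+1)%N -> exists2 dd, close (f (Hs l)) dd &
      c = dd (size u) /\ forall p, (p < size u)%N -> nth false u p = dd p) ->
    adm (rcons u c).
  move=> [hu au] c0 hc; split; first by case: u c0 hu {au hc} => //= ->.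
  move=> l; rewrite size_rcons leq_eqVlt => /predU1P[Gl|].
    have [dd cl ag] := ext l (nth false (rcons u c)).
    by exists dd => // p pu _; apply: ag; rewrite Gl.
  rewrite ltnS => Gl; have [hl|lh] := leqP (Hs l.+1) (size u).
    have [dd cl ag] := au l Gl; exists dd => // p _ ph.
    by rewrite nth_rcons (leq_trans ph hl) ag// (leq_trans ph hl).
  have [|dd cl [cd ag]] := hc l; first by rewrite Gl.
  exists dd => // p; rewrite ltnS leq_eqVlt nth_rcons => /predU1P[->|pu] _.
    by rewrite ltnn eqxx.
  by rewrite pu ag.
(* Forced parts are disjoint, so at most one block constrains the next digit. *)
have disj l l' n : (G l <= n < Hs l.+1)%N -> (G l' <= n < Hs l'.+1)%N -> l = l'.
  move=> /andP[a b] /andP[a' b']; case: (ltngtP l l') => // ll.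
    by have := leq_trans (Hs_le _ _ ll) (HG l'); lia.
  by have := leq_trans (Hs_le _ _ ll) (HG l); lia.
apply: (@hausdorff_measure_branch_neq0 R adm free (fun n => 2 ^- N n) s (t * kappa) 2) => //.
- by move=> n; rewrite NS; case: (free n); rewrite ?addn1 ?addn0// exprS invfM mulrC.
- by split=> // l /=; have := Hs_lt l; have := HG l; lia.
- move=> u au; have [[l gl]|no] := pselect (exists l, (G l <= size u < Hs l.+1)%N).
    have [dd cl ag] := au.2 l (proj1 (andP gl)).
    exists (dd (size u)); apply: adm_step => //.
      move=> u0; move: gl; rewrite u0 => /andP[+ _].
      by have := Hs_lt l; have := HG l; lia.
    move=> l' /(disj _ _ _ gl) <-; exists dd => //; split=> // p pu.
    by apply: ag => //; case/andP: gl => _; exact: ltn_trans.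
  by exists false; apply: adm_step => // l gl; case: no; exists l.
- move=> u c au /asboolP[l /andP[hu ug]]; apply: adm_step => //.
    by move=> u0; have := Hs_lt l; lia.
  move=> l' /andP[a b]; exfalso; case: (leqP l l') => ll.
    move: ll; rewrite leq_eqVlt => /predU1P[e|ll]; first by rewrite -e in a; lia.
    by have := leq_trans (Hs_le _ _ ll) (HG l'); have := GH l; lia.
  by have := Hs_le _ _ ll; lia.
- by move=> u [].
- by rewrite mulr_gt0// kappa_gt0.
- move=> n; rewrite pow3VE -powRrM.
  have -> : - n%:R * (t * kappa) = kappa * - (t * n%:R) :> R by ring.
  rewrite powRrM powR3_kappa -powR_invn// -[X in X * _](@powRr1 R 2)// -powRD ?pnatr_eq0 ?implybT//.
  by apply: ler_powR; [rewrite ler1n|have := tN n; lra].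
- move=> omega au; have Kx : Kset (branch_point omega : R).
    by apply: branch_point_K; apply/negbTE; have [] := au 1%N.
  split=> //; split; first by case: Kx.
  apply: ereal_sup_ubound; exists v => //.
  apply: (@close_Fb (fun l => f (Hs l))) => //; first by case: Kx.
  move=> l; have [_ /(_ l)] := au (Hs l.+1).
  rewrite size_mkseq => /(_ (ltnW (GH l)))[dd [k [kK yK yd]] ag].
  exists k; split=> //; move: yd; rewrite (@eq_cyl R (h (f (Hs l))) dd omega)// => p ph.
  by rewrite -ag// nth_mkseq.
Qed.

End Blocks.

Lemma Vbullet_dim_ge v s : 0 <= v ->
  hausdorff_measure s (Vbullet (3 ^ m) y v `&` Kset) = 0%E -> kappa / (v + 1) <= s.
Proof.
move=> v0 H0; rewrite leNgt; apply/negP => sk.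
have v1 : 0 < v + 1 by rewrite ltr_wpDl.
have k0 := @kappa_gt0 R.
have sv : s / kappa < (v + 1)^-1 by rewrite ltr_pdivrMr// mulrC.
(* The midpoint between [s / kappa] and [1 / (v + 1)]; the maximum with [0] keeps [t] positive when
   [s] is negative. *)
pose t := (Num.max (s / kappa) 0 + (v + 1)^-1) / 2.
have mx : Num.max (s / kappa) 0 < (v + 1)^-1 by rewrite gt_max sv invr_gt0.
have [mx0 mxs] : 0 <= Num.max (s / kappa) 0 /\ s / kappa <= Num.max (s / kappa) 0.
  by rewrite !le_max !lexx orbT.
have tv : t < (v + 1)^-1 by rewrite /t; lra.
have d0 : 0 < 1 - t * (v + 1) by rewrite subr_gt0 -ltr_pdivlMr// div1r.
(* [gap] amounts to [1 < (q + 1) (1 - t (v + 1))]. *)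
have dq := truncnS_gt (1 - t * (v + 1))^-1.
set q := Num.truncn _ in dq.
apply: (@Vbullet_measure_neq0 v t q _ _ _ _ s _ H0) => //.
- by rewrite /t; have : 0 < (v + 1)^-1 by [rewrite invr_gt0]; lra.
- by apply: lt_le_trans tv _; rewrite invf_le1// lerDr.
- move: dq; rewrite -[ltLHS]mul1r ltr_pdivrMr// -natr1 => dq; lra.
- by rewrite -ler_pdivrMr// /t; lra.
Qed.

End LowerBound.

(** * Upper bound for the dimension *)

Section LimsupCover.
Context {R : realType}.

(** Every tail of the sequence covers [A], and the tails of a convergent series vanish. *)
Lemma hausdorff_measure_limsup_eq0 (s : R) (U : nat -> set R) (D : nat -> R) (A : set R) :
  0 < s -> (forall i, U i `<=` torus) -> (forall i, 0 <= D i) ->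
  (forall i x y, U i x -> U i y -> dT x y <= D i) ->
  (\sum_(i <oo) (D i `^ s)%:E < +oo)%E ->
  (forall x, A x -> forall I, exists2 i, (I <= i)%N & U i x) ->
  hausdorff_measure s A = 0%E.
Proof.
move=> s0 Ut D0 UD Dfin AU; apply/eqP; rewrite eq_le hausdorff_measure_ge0 andbT.
apply: ge_ereal_sup => _ [delta /= d0 <-].
apply/lee_addgt0Pr => e e0; rewrite add0e.
have Ds0 i : true -> (0 <= (D i `^ s)%:E)%E by rewrite lee_fin powR_ge0.
have /fine_cvgP[fin /cvgrPdist_lt tail] := nneseries_tail_cvg Dfin Ds0.
(* A tail below [e'] bounds the sum by [e] and each diameter by [delta]. *)
pose e' := Num.min e (delta `^ s).
have e'0 : 0 < e' by rewrite lt_min e0 powR_gt0.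
have [N [finN tailN]] : exists N, (\sum_(N <= k <oo) (D k `^ s)%:E)%E \is a fin_num /\
    (\sum_(N <= k <oo) (D k `^ s)%:E < e'%:E)%E.
  have [N1 _ h1] := fin; have [N2 _ h2] := tail _ e'0.
  have hf := h1 (maxn N1 N2) (leq_maxl _ _).
  exists (maxn N1 N2); split=> //.
  have := h2 (maxn N1 N2) (leq_maxr _ _) => /=; rewrite sub0r normrN.
  move=> /(le_lt_trans (ler_norm _)).
  by rewrite -[in X in _ -> X](fineK hf) lte_fin.
have Dk k : (N <= k)%N -> D k `^ s < e'.
  move=> Nk; rewrite -lte_fin; apply: le_lt_trans tailN.
  have := @nneseries_lim_ge R (fun k => (D k `^ s)%:E) xpredT N k.+1 (fun i _ => Ds0 i).
  apply: le_trans.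
  rewrite big_nat_recr//= leeDr//; apply: sume_ge0 => i _; exact: Ds0.
pose V i := if (N <= i)%N then U i else set0.
have VU i : V i `<=` U i by move=> x; rewrite /V; case: ifP.
apply: le_trans (@hausdorff_approx_le _ _ _ _ V _ _ _) _.
- by move=> i; apply: subset_trans (Ut i).
- move=> i; rewrite /V; case: ifP => [Ni|_]; last by apply: diamT_le => //; exact: ltW.
  apply: le_trans (diamT_le (D0 i) (@UD i)) _.
  rewrite leNgt; apply/negP => dD.
  have := lt_le_trans (Dk i Ni) (_ : e' <= delta `^ s).
  rewrite ge_min lexx orbT => /(_ isT); rewrite ltNge => /negP; apply.
  by apply: ge0_ler_powR; rewrite ?nnegrE ?(ltW s0) ?(ltW d0) ?(ltW dD)//.
- by move=> x /AU/(_ N)[i Ni Ui]; exists i => //; rewrite /V Ni.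
rewrite (@nneseries_split _ _ 0 N); last by move=> k _; rewrite lee_fin diam_pow_ge0.
rewrite add0n big1_seq ?add0e; last first.
  move=> i; rewrite mem_index_iota => /andP[_ /andP[_ iN]].
  by rewrite /V leqNgt iN /diam_pow; case: asboolP.
apply: (@le_trans _ _ (\sum_(N <= k <oo) (D k `^ s)%:E)%E); last first.
  by rewrite (le_trans (ltW tailN))// lee_fin ge_min lexx.
apply: lee_nneseries => [i _ _|i _]; first by rewrite lee_fin diam_pow_ge0.
rewrite lee_fin; apply: diam_pow_le => //; first exact: ltW.
by move=> x y /VU Ux /VU Uy; exact: UD.
Qed.

Lemma sum_mem_le (s : seq nat) M : \sum_(0 <= k < M) (k \in s)%:R <= (size s)%:R :> R.
Proof.
rewrite -natr_sum ler_nat.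
rewrite (eq_bigr (fun k => if k \in s then 1 else 0)%N); last by move=> k _; case: (k \in s).
rewrite -big_mkcond sum1_count -size_filter uniq_leq_size ?filter_uniq ?iota_uniq//.
by move=> k; rewrite mem_filter => /andP[].
Qed.

(* The blocks [b^j <= i < b^(j+1)] correspond to the enumeration of the pairs
   [(j, k)] with [k < b^j] by [i = b^j + k]. *)
Lemma block_summable (b : nat) (a : nat -> R) (C rho : R) : (1 < b)%N ->
  (forall i, 0 <= a i) -> a 0%N = 0 -> 0 <= rho < 1 ->
  (forall J, \sum_(b ^ J <= i < b ^ J.+1) a i <= C * rho ^+ J) ->
  (\sum_(i <oo) (a i)%:E < +oo)%E.
Proof.
move=> b1 a0 a00 /andP[r0 r1] H.
have b0 : (0 < b)%N by exact: ltnW.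
(* Partial geometric sums, multiplied by [1 - rho]. The blocks start at [b^0 = 1], hence the
   assumption on [a 0]. *)
have S J : (\sum_(0 <= i < b ^ J) a i) * (1 - rho) <= C * (1 - rho ^+ J).
  elim: J => [|J IH]; first by rewrite expn0 big_nat1 a00 mul0r expr0 subrr mulr0.
  rewrite (@big_cat_nat _ _ _ (b ^ J))//=; last by rewrite leq_exp2l.
  rewrite mulrDl; apply: le_trans (lerD IH (_ : _ <= C * rho ^+ J * (1 - rho))) _.
    by rewrite ler_wpM2r ?subr_ge0 ?(ltW r1).
  by rewrite exprS le_eqVlt; apply/orP; left; apply/eqP; ring.
have C0 : 0 <= C.
  have := H 0%N; rewrite expr0 mulr1; apply: le_trans.
  by apply: sumr_ge0.
apply: (@le_lt_trans _ _ (C / (1 - rho))%:E); last exact: ltry.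
apply: lime_le; first by apply: is_cvg_nneseries => i _ _; rewrite lee_fin.
apply: nearW => n; rewrite sumEFin lee_fin ler_pdivlMr ?subr_gt0//.
apply: (@le_trans _ _ (C * (1 - rho ^+ n))).
  apply: le_trans (S n); rewrite ler_wpM2r ?subr_ge0 ?(ltW r1)//.
  rewrite (@big_cat_nat _ _ _ n 0 (b ^ n))//=; last by rewrite ltnW// ltn_expl.
  by rewrite lerDl; apply: sumr_ge0.
by rewrite ler_piMr// gerDl oppr_le0 exprn_ge0.
Qed.

Lemma cantor_left_true p : cantor_left p (fun=> true) = 1 - (3 ^+ p)^-1 :> R.
Proof.
elim: p => [|p IH]; first by rewrite cantor_left0 expr0 invr1 subrr.
by rewrite cantor_leftS IH (pow3VS p) mul1r; lra.
Qed.

(** Each cylinder is enlarged by its own length on both sides, which triples the lengths and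
    captures all points within [3^-p] of [K]. *)
Definition Kset_nbhd p : set R := \bigcup_(w in [set` words p])
  `[cantor_left p (nth false w) - (3 ^+ p)^-1,
    cantor_left p (nth false w) + 2 * (3 ^+ p)^-1]%classic.

Lemma measurable_Kset_nbhd p : measurable (Kset_nbhd p).
Proof.
by rewrite /Kset_nbhd bigcup_seq; apply: bigsetU_measurable => w _; exact: measurable_itv.
Qed.

Lemma Kset_nbhdP p (xi z : R) : Kset xi -> torus z -> dT xi z <= (3 ^+ p)^-1 ->
  Kset_nbhd p z.
Proof.
move=> [Cxi txi] tz; have p0 := @pow3V_gt0 R p.
have nb d : cantor_left p d - (3 ^+ p)^-1 <= z -> z <= cantor_left p d + 2 * (3 ^+ p)^-1 ->
    Kset_nbhd p z.
  move=> h1 h2; have [w [wd _]] := @cyl_wcyl R p d.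
  exists w; first by rewrite /= mem_enum.
  by rewrite /= in_itv/= (@eq_cantor_left R p _ d)// h1 h2.
rewrite dT_torus// ge_min => /orP[|].
  have := Cxi; rewrite cantor_setE => /(_ p)[d /cylE/andP[? ?]].
  by rewrite ler_norml => /andP[? ?]; apply: (nb d); lra.
(* Here the short arc passes through [0], so [z] is within [3^-p] of [0] or [1], ends of the first
   and last cylinders. *)
move: tz txi; rewrite /torus/= !in_itv/= => /andP[z0 z1] /andP[x0 x1].
have zero : cantor_left p (fun=> false) = 0 :> R.
  by rewrite /cantor_left big1// => i _; rewrite mul0r.
have [xz|zx] := leP z xi.
  by rewrite ger0_norm ?subr_ge0// => ?; apply: (nb (fun=> false)); rewrite zero; lra.
rewrite ltr0_norm ?subr_lt0// => ?; apply: (nb (fun=> true)); rewrite cantor_left_true; lra.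
Qed.

Lemma lebesgue_measure_Kset_nbhd p :
  (lebesgue_measure (Kset_nbhd p `&` torus) <= (3 * (2 ^+ p / 3 ^+ p))%:E)%E.
Proof.
apply: (@le_trans _ _ (lebesgue_measure (Kset_nbhd p))).
  apply: le_measure; rewrite ?inE; [|exact: measurable_Kset_nbhd|by move=> x []].
  by apply: measurableI; [exact: measurable_Kset_nbhd|exact: measurable_itv].
apply: le_trans (measure_bigcup_seq_le _ _ _) _; first by move=> w; exact: measurable_itv.
rewrite (eq_bigr (fun=> (3 / 3 ^+ p)%:E)); last first.
  move=> w _; have p0 := @pow3V_gt0 R p.
  rewrite /= lebesgue_measure_itv/= lte_fin ifT; last by lra.
  by rewrite -EFinB; congr EFin; ring.
rewrite sumEFin lee_fin big_const_seq count_predT size_words iter_addr_0.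
by rewrite -[_ *+ (2 ^ _)%N]mulr_natl natrX mulrCA.
Qed.

End LimsupCover.

Section UpperBound.
Context {R : realType} {d : measure_display} {Omega : measurableType d}.
Variables (P : probability Omega R) (m : nat) (Y : nat -> nat -> Omega -> R).
Hypothesis m_gt0 : (0 < m)%N.
Hypothesis mY : forall j k, measurable_fun setT (Y j k).
Hypothesis torusY : forall j k w, torus (Y j k w).
Hypothesis lawL : forall j k, (1 <= j)%N -> Kj (3 ^ m) j k -> ~ @KjK R (3 ^ m) j k ->
  forall B : set R, measurable B -> P (Y j k @^-1` B) = lebesgue_measure (B `&` torus).
Variables (alpha s : R).
Hypotheses (alpha_gt0 : 0 < alpha) (s_gt0 : 0 < s).
Hypotheses (alpha_s : kappa < alpha * s) (alpha_s1 : 1 < alpha * (s + 1 - kappa)).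

Let b := (3 ^ m)%N.
(** The ternary level of the radius: [3^-(p j)] is at least [b^-(alpha j)] and less than three times
    it. *)
Let p j := Num.truncn (alpha * (m * j)%:R).

(** The event that the ball of index [(j, k)] has to be kept in the cover of [K]; it is empty off
    [idx], so that sums may run over all pairs. *)
Definition near_K j k : set Omega :=
  if `[< idx b (j, k) >] then
    if `[< @KjK R b j k >] then setT else Y j k @^-1` Kset_nbhd (p j)
  else set0.

Lemma measurable_near_K j k : measurable (near_K j k).
Proof.
rewrite /near_K; case: ifP => // _; case: ifP => // _.
exact: measurable_preimage (mY _ _) _ (@measurable_Kset_nbhd R _).
Qed.

Lemma near_K_le j k : (P (near_K j k) <=
  ((k \in all_codes (m * j))%:R +
   (k \in iota 0 (3 ^ (m * j)))%:R * (3 * (2 ^+ p j / 3 ^+ p j)))%:E)%E.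
Proof.
have L0 : 0 <= 3 * (2 ^+ p j / 3 ^+ p j) :> R by rewrite mulr_ge0 ?divr_ge0 ?exprn_ge0.
rewrite /near_K; case: asboolP => [[/= j1 kj]|_]; last first.
  by rewrite measure0 lee_fin addr_ge0// mulr_ge0.
have kb : k \in iota 0 (3 ^ (m * j)).
  by rewrite mem_iota add0n expnM; case: kj.
rewrite kb mul1r; case: asboolP => [kK|nK].
  rewrite (KjK_all_codes kK) probability_setT lee_fin lerDl//.
rewrite (lawL j1 kj nK); last exact: measurable_Kset_nbhd.
apply: le_trans (lebesgue_measure_Kset_nbhd _) _.
by rewrite lee_fin lerDr.
Qed.

(** [jj] and [kk] invert the enumeration [i = b^j + k]. *)
Let jj i := trunc_log b i.
Let kk i := (i - b ^ jj i)%N.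
Let r j : R := 2 * (3 ^+ p j)^-1.

Let eta := Num.min (alpha * s - kappa) (alpha * (s + 1 - kappa) - 1).

Lemma b_gt1 : (1 < b)%N.
Proof. by rewrite /b -(expn0 3) ltn_exp2l. Qed.

Lemma r_ge0 j : 0 <= r j.
Proof. by rewrite /r mulr_ge0// ltW// pow3V_gt0. Qed.

(** Up to constants the two terms are [b^J] to the powers [kappa - alpha s] and
    [1 - alpha (s + 1 - kappa)], both negative by [alpha_s] and [alpha_s1]; [eta] is the slower
    decay rate. *)
Lemma block_cost J : r J `^ s * (2 * 2 ^+ (m * J) +
    3 ^+ (m * J) * (3 * (2 ^+ p J / 3 ^+ p J))) <=
  2 `^ s * 3 `^ s * 11 * (3 `^ (- eta)) ^+ J.
Proof.
set n := (m * J)%N.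
have pn : alpha * n%:R < (p J)%:R + 1 by rewrite natr1; exact: truncnS_gt.
have k1 := @kappa_lt1 R; have k0 := @kappa_gt0 R.
have rE : r J `^ s = 2 `^ s * 3 `^ (- (p J)%:R * s).
  by rewrite /r powRM// ?pow3VE ?powR_ge0// -powRrM.
have twoE N : 2 ^+ N = 3 `^ (kappa * N%:R) :> R by rewrite powRrM powR3_kappa powR_mulrn.
have threeE N : 3 ^+ N = 3 `^ N%:R :> R by rewrite powR_mulrn.
have e1 : eta <= alpha * s - kappa by rewrite /eta ge_min lexx.
have e2 : eta <= alpha * (s + 1 - kappa) - 1 by rewrite /eta ge_min lexx orbT.
have eta0 : 0 < eta by rewrite /eta lt_min !subr_gt0 alpha_s alpha_s1.
have Jn : J%:R <= n%:R :> R by rewrite ler_nat leq_pmull.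
have n0 : 0 <= n%:R :> R by [].
have etaJ : eta * J%:R <= eta * n%:R by rewrite ler_pM2l.
have neta1 : eta * n%:R <= (alpha * s - kappa) * n%:R by rewrite ler_wpM2r.
have neta2 : eta * n%:R <= (alpha * (s + 1 - kappa) - 1) * n%:R by rewrite ler_wpM2r.
have ps : s * (alpha * n%:R) <= s * ((p J)%:R + 1) by rewrite ler_pM2l// ltW.
have pk : (1 - kappa) * (alpha * n%:R) <= (1 - kappa) * ((p J)%:R + 1).
  by rewrite ler_pM2l ?ltW// subr_gt0.
have -> : (3 `^ (- eta)) ^+ J = 3 `^ (- (eta * J%:R)) :> R.
  by rewrite -powR_mulrn ?powR_ge0// -powRrM mulNr.
rewrite rE -!mulrA ler_pM2l ?powR_gt0//.
rewrite mulrDr.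
(* The constant [11] is [2 + 9]: [2] counts both ends of each cylinder, and [9] is the tripled
   length times a bound [3] for the rounding of [p J]. The factor [3^s] is the rounding in the
   diameters. *)
have h1 : 3 `^ (- (p J)%:R * s) * (2 * 2 ^+ n) <= 2 * (3 `^ s * 3 `^ (- (eta * J%:R))) :> R.
  rewrite mulrCA ler_pM2l// twoE -!powRD ?pnatr_eq0 ?implybT//.
  by apply: ler_powR; [rewrite ler1n|lra].
have h2 : 3 `^ (- (p J)%:R * s) * (3 ^+ n * (3 * (2 ^+ p J / 3 ^+ p J)))
    <= 9 * (3 `^ s * 3 `^ (- (eta * J%:R))) :> R.
  have -> : 3 `^ (- (p J)%:R * s) * (3 ^+ n * (3 * (2 ^+ p J / 3 ^+ p J))) =
      3 * 3 `^ (- (p J)%:R * s + (n%:R + (kappa * (p J)%:R - (p J)%:R))) :> R.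
    by rewrite twoE !threeE -powRN !powRD ?pnatr_eq0 ?implybT//; ring.
  have -> : 9 * (3 `^ s * 3 `^ (- (eta * J%:R))) = 3 * 3 `^ (1 + (s - eta * J%:R)) :> R.
    by rewrite !powRD ?pnatr_eq0 ?implybT// powRr1//; ring.
  by rewrite ler_pM2l//; apply: ler_powR; [rewrite ler1n|lra].
have := lerD h1 h2; move=> /le_trans; apply.
by rewrite -mulrDl mulrC mulrA le_eqVlt; apply/orP; left; apply/eqP; ring.
Qed.

Lemma near_K_summable :
  (\sum_(i <oo) (r (jj i) `^ s * fine (P (near_K (jj i) (kk i))))%:E < +oo)%E.
Proof.
have fP j k := probability_fin P (measurable_near_K j k).
have pos j k : 0 <= fine (P (near_K j k)) by exact: fine_ge0 (measure_ge0 _ _).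
apply: (@block_summable R b _ (2 `^ s * 3 `^ s * 11) (3 `^ (- eta))).
- exact: b_gt1.
- by move=> i; rewrite mulr_ge0 ?powR_ge0.
(* [trunc_log b 0] is [0], and generation [0] is outside [idx]. *)
- rewrite (_ : near_K _ _ = set0) ?measure0 ?mulr0// /near_K.
  by case: asboolP => // -[] /=; rewrite /jj /trunc_log; case: b => [|[]].
- rewrite powR_ge0/=; have := @ltr_powR3 R (- eta) 0; rewrite powRr0; apply.
  by rewrite oppr_lt0 /eta lt_min !subr_gt0 alpha_s alpha_s1.
move=> J; apply: le_trans (block_cost J).
rewrite -{1}[(b ^ J)%N]add0n big_addn.
set M := (_ - _)%N.
apply: (@le_trans _ _ (\sum_(0 <= k < M) r J `^ s * ((k \in all_codes (m * J))%:R +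
   (k \in iota 0 (3 ^ (m * J)))%:R * (3 * (2 ^+ p J / 3 ^+ p J))))).
  apply: ler_sum_nat => k /andP[_ kM].
  have -> : jj (k + b ^ J) = J.
    apply: trunc_log_eq; first exact: b_gt1.
    by rewrite leq_addl/=; move: kM; rewrite /M; lia.
  rewrite /kk.
  have -> : jj (k + b ^ J) = J.
    apply: trunc_log_eq; first exact: b_gt1.
    by rewrite leq_addl/=; move: kM; rewrite /M; lia.
  by rewrite addnK ler_wpM2l ?powR_ge0// -lee_fin fineK// near_K_le.
rewrite -mulr_sumr ler_wpM2l ?powR_ge0// big_split /= lerD//.
  apply: le_trans (sum_mem_le _ _) _.
  by rewrite size_all_codes natrM natrX.
rewrite -mulr_suml ler_wpM2r//.
by apply: le_trans (sum_mem_le _ _) _; rewrite size_iota natrX.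
Qed.

(** The random sum of [s]-th powers has finite expectation, hence is almost surely finite. The null
    set depends on [alpha] and [s] only and serves all [v] at once. *)
Lemma ae_Vbullet_measure0 : {ae P, forall w, forall v, alpha < v + 1 ->
  hausdorff_measure s (Vbullet b (fun j k => Y j k w) v `&` Kset) = 0%E}.
Proof.
pose f i w : \bar R := ((r (jj i) `^ s) * \1_(near_K (jj i) (kk i)) w)%:E.
have f0 i w : (0 <= f i w)%E by rewrite lee_fin mulr_ge0 ?powR_ge0.
have mf i : measurable_fun setT (f i).
  apply/measurable_EFinP; apply: measurable_funM => //.
  exact: measurable_indic (measurable_near_K _ _).
have mF : measurable_fun setT (fun w => \sum_(i <oo) f i w)%E.
  by apply: ge0_emeasurable_sum.
have iF : P.-integrable setT (fun w => \sum_(i <oo) f i w)%E.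
  apply/integrableP; split=> //.
  rewrite (eq_integral (fun w => \sum_(i <oo) f i w)%E); last first.
    by move=> w _; rewrite gee0_abs// nneseries_ge0.
  rewrite integral_nneseries//.
  apply: le_lt_trans near_K_summable.
  apply: lee_nneseries => [i _ _|i _]; first exact: integral_ge0.
  rewrite (_ : f i = fun w => (r (jj i) `^ s)%:E * (\1_(near_K (jj i) (kk i)) w)%:E)%E; last first.
    by apply/funext => w; rewrite -EFinM.
  rewrite ge0_integralZl_EFin ?powR_ge0//; last first.
    by apply/measurable_EFinP; exact: measurable_indic (measurable_near_K _ _).
  rewrite integral_indic//; last exact: measurable_near_K.
  by rewrite setIT EFinM fineK// (probability_fin P (measurable_near_K _ _)).
have := integrable_ae measurableT iF; apply: filterS => w /(_ I) wfin v av.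
pose U i : set R := [set z | near_K (jj i) (kk i) w /\ torus z /\
  dT z (Y (jj i) (kk i) w) <= (3 ^+ p (jj i))^-1].
(* Zero for a discarded ball, so that, as [0 < s], its [s]-th power is exactly [f i w]. *)
pose D i : R := if `[< near_K (jj i) (kk i) w >] then r (jj i) else 0.
apply: (@hausdorff_measure_limsup_eq0 R s U D) => //.
- by move=> i z [_ []].
- by move=> i; rewrite /D; case: ifP => // _; exact: r_ge0.
- move=> i x y [nK [_ xY]] [_ [_ yY]]; rewrite /D asboolT// /r.
  have := dT_triangle (Y (jj i) (kk i) w) x y; rewrite (dTC (Y _ _ _) y); lra.
- have fD i : (D i `^ s)%:E = f i w.
    rewrite /f /D indicE; have [h|h] := pselect (near_K (jj i) (kk i) w).
      by rewrite asboolT// mem_set// mulr1.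
    by rewrite asboolF// memNset// mulr0 powR0// gt_eqF.
  under eq_eseriesr do rewrite fD.
  by rewrite ge0_fin_numE// in wfin; exact: nneseries_ge0.
move=> xi [[txi vxi] Kxi] I.
(* Some exponent [u > alpha - 1] is attained, and its balls fit in radius [3^-(p j)]. *)
have [_ [u [_ Fu] <-] au] : exists2 y,
    [set u%:E | u in [set u : R | Fb b (fun j k => Y j k w) u xi]] y &
    ((alpha - 1)%:E < y)%E.
  by apply: ereal_sup_gt; apply: lt_le_trans vxi; rewrite lte_fin; lra.
rewrite lte_fin in au.
(* Only finitely many pairs satisfy [b^j + k < I], while infinitely many balls contain [xi]. *)
have [j [k [[/= [/= j1 kj] dxi] jkI]]] : exists j k,
    (idx b (j, k) /\ dT xi (Y j k w) < b%:R `^ (- ((u + 1) * j%:R))) /\ (I <= b ^ j + k)%N.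
  apply: contrapT => no; apply: Fu.
  apply: (@sub_finite_set _ _ (`I_I `*` `I_I)); last exact: finite_setX.
  move=> [j k] /= jk; have : (b ^ j + k < I)%N.
    by rewrite ltnNge; apply/negP => Ij; apply: no; exists j, k.
  have := ltn_expl j b_gt1; split=> /=; lia.
have ij : jj (b ^ j + k) = j.
  apply: trunc_log_eq; first exact: b_gt1.
  rewrite leq_addr/= expnS; case: kj => kb _.
  by have := b_gt1; move: kb; set B := (b ^ j)%N; nia.
have ik : kk (b ^ j + k) = k by rewrite /kk ij addKn.
have rad : dT xi (Y j k w) <= (3 ^+ p j)^-1.
  apply/ltW/(lt_le_trans dxi); rewrite radiusE pow3VE.
  apply: ler_powR; first by rewrite ler1n.
  rewrite lerN2; apply: (@le_trans _ _ (alpha * (m * j)%:R)).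
    by rewrite truncn_le mulr_ge0// ltW.
  by rewrite natrM [leLHS]mulrCA -[leRHS]mulrA ler_wpM2l// ler_wpM2r//; lra.
exists (b ^ j + k)%N => //; rewrite /U /= ij ik; split=> //.
rewrite /near_K asboolT; last by split.
case: asboolP => // nK.
exact: Kset_nbhdP Kxi (torusY _ _ _) rad.
Qed.

End UpperBound.

(** * A common null set and the final assembly *)

Lemma ae_countable {d : measure_display} {T : measurableType d} {R : realType}
    (mu : {measure set T -> \bar R}) (I : countType) (Q : I -> T -> Prop) :
  (forall i, {ae mu, forall x, Q i x}) -> {ae mu, forall x, forall i, Q i x}.
Proof.
move=> H.
have : {ae mu, forall x, forall n : nat, if unpickle n is Some i then Q i x else True}.
  by apply: ae_foralln => n; case: (unpickle n) => [i|]; [exact: H|exact: nearW].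
by apply: filterS => x Hx i; have := Hx (pickle i); rewrite pickleK.
Qed.

Theorem theorem2p7 (R : realType) (d : measure_display) (Omega : measurableType d)
  (P : probability Omega R) (b : nat) (Y : nat -> nat -> Omega -> R) :
  (exists m : nat, (0 < m)%N /\ b = (3 ^ m)%N) ->
  (* the Y_{j,k} are random points of T = [0,1) *)
  (forall j k, measurable_fun setT (Y j k)) ->
  (forall j k w, torus (Y j k w)) ->
  (* independence of the family (Y_{j,k})_{j >= 1, k in K^j} *)
  mutually_independent P (idx b) (fun jk => Y jk.1 jk.2) ->
  (* laws: normalized kappa-dim Hausdorff measure on K if k in K^j_K *)
  (forall j k, (1 <= j)%N -> @KjK R b j k -> forall B : set R, measurable B ->
     (P (Y j k @^-1` B) * hausdorff_measure kappa Kset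
      = hausdorff_measure kappa (B `&` Kset))%E) ->
  (* ... and Lebesgue measure on T otherwise *)
  (forall j k, (1 <= j)%N -> Kj b j k -> ~ @KjK R b j k -> forall B : set R,
     measurable B -> P (Y j k @^-1` B) = lebesgue_measure (B `&` torus)) ->
  {ae P, forall w,
     (forall xi, Kset xi -> (0 <= vbullet b (fun j k => Y j k w) xi)%E) /\
     (forall v : R, 0 <= v ->
        hausdorff_dim (Vbullet b (fun j k => Y j k w) v `&` Kset)
        = (kappa / (v + 1))%:E)}.
Proof.
move=> [m [m0 ->]] mY tY indY lawK lawL.
(* Rational pairs [(alpha, s)] leave countably many null sets to merge. *)
have upper : {ae P, forall w, forall q : rat * rat,
    0 < ratr q.1 :> R -> 0 < ratr q.2 :> R -> kappa < ratr q.1 * ratr q.2 :> R ->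
    1 < ratr q.1 * (ratr q.2 + 1 - kappa) :> R -> forall v, ratr q.1 < v + 1 ->
    hausdorff_measure (ratr q.2) (Vbullet (3 ^ m) (fun j k => Y j k w) v `&` Kset) = 0%E}.
  apply: ae_countable => q.
  have [[h1 h2 h3 h4]|no] := pselect [/\ 0 < ratr q.1 :> R, 0 < ratr q.2 :> R,
      kappa < ratr q.1 * ratr q.2 :> R & 1 < ratr q.1 * (ratr q.2 + 1 - kappa) :> R].
    by have := ae_Vbullet_measure0 m0 mY tY lawL h1 h2 h3 h4; apply: filterS => w.
  by apply: nearW => w h1 h2 h3 h4; case: no.
have := ae_covered m0 mY indY lawK.
apply: filterS2 upper => w up cov; split=> [xi Kxi|v v0].
  exact: (@vbullet_ge0 R m (fun j k => Y j k w)).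
have v1 : 0 < v + 1 by lra.
have k0 := @kappa_gt0 R; have k1 := @kappa_lt1 R.
apply/eqP; rewrite eq_le; apply/andP; split; last first.
  apply: le_ereal_inf_tmp => _ [s [s0 H0] <-]; rewrite lee_fin.
  exact: (@Vbullet_dim_ge R m (fun j k => Y j k w)).
apply/lee_addgt0Pr => e e0; rewrite -EFinD.
have [|s] := @rat_in_itvoo R (kappa / (v + 1)) (kappa / (v + 1) + e); first by lra.
rewrite in_itv/= => /andP[s1 s2].
have s0 : 0 < ratr s :> R by apply: lt_trans s1; rewrite divr_gt0.
have ks : kappa < (v + 1) * ratr s by rewrite mulrC -ltr_pdivrMr.
have vk : (v + 1) * kappa >= kappa by rewrite ler_peMl ?(ltW k0)//; lra.
have sk : 0 < ratr s + 1 - kappa :> R by lra.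
(* Room for [alpha] below [v + 1]: from [s > kappa / (v + 1)], [(v + 1) (s + 1 - kappa)] exceeds
   [v + 1 - v kappa], which is at least [1]. *)
have [|a] := @rat_in_itvoo R (Num.max (kappa / ratr s) (ratr s + 1 - kappa)^-1) (v + 1).
  rewrite gt_max ltr_pdivrMr// ks/= -[ltLHS]mul1r ltr_pdivrMr//.
  have : v * kappa <= v by rewrite ler_piMr ?(ltW k1).
  lra.
rewrite in_itv/= gt_max => /andP[/andP[a1 a2] a3].
have a0 : 0 < ratr a :> R by apply: lt_trans a1; rewrite divr_gt0.
apply: le_trans (_ : (ratr s)%:E <= _)%E; last by rewrite lee_fin ltW.
apply: ereal_inf_lbound; exists (ratr s) => //; split; first exact: ltW.
apply: (up (a, s)) => //=; first by rewrite -ltr_pdivrMr.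
by rewrite -ltr_pdivrMr// div1r.
Qed.
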